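(* Let $n\ge 2$. The multivariable Bost--Connes algebra $\mathcal{A}_{BC,n}=C^*(\mathbb{Q}/\mathbb{Z})^{\otimes n}\rtimes_\rho M_n(\mathbb{Z})^+$ has a time evolution $\sigma:\mathbb{R}\to\mathrm{Aut}(\mathcal{A}_{BC,n})$ defined by setting $$\sigma_t(\mu_\alpha)=\det(\alpha)^{it}\mu_\alpha\quad\forall\alpha\in M_n(\mathbb{Z})^+,\qquad \sigma_t(e(\underline{r}))=e(\underline{r})\quad\forall\underline{r}\in(\mathbb{Q}/\mathbb{Z})^n.$$ Let $H$ be the Hamiltonian that generates this time evolution in a representation $\pi_\rho$ of $\mathcal{A}_{BC,n}$ on $\mathcal{H}_n=\ell^2(M_n(\mathbb{Z})^+)$, with $\rho\in\mathrm{GL}_n(\hat{\mathbb{Z}})$. The operator $H$ has eigenvalues $\log\det(\alpha)$ with infinite multiplicities.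
   Context: $M_n(\mathbb{Z})^+$ is the multiplicative semigroup of integer $n\times n$ matrices with positive determinant. $C^*(\mathbb{Q}/\mathbb{Z})^{\otimes n}$ is generated by the elements $e(\underline{r})=e(r_1)\otimes\cdots\otimes e(r_n)$, $\underline{r}=(r_1,\ldots,r_n)\in(\mathbb{Q}/\mathbb{Z})^n$, where $e(r)$, $r\in\mathbb{Q}/\mathbb{Z}$, are the canonical generators of the group $C^*$-algebra. The algebra $\mathcal{A}_{BC,n}$ is the semigroup crossed product generated by these and by isometries $\mu_\alpha$, $\alpha\in M_n(\mathbb{Z})^+$, with $\mu_\alpha\mu_\beta=\mu_{\alpha\beta}$, $\mu_\alpha^*\mu_\beta=\mu_\gamma$ if $\beta=\alpha\gamma$ with $\gamma\in M_n(\mathbb{Z})^+$ (so $\mu_\alpha^*\mu_\alpha=1$), where the semigroup action is $$\rho_\alpha(e(\underline{r}))=\mu_\alpha e(\underline{r})\mu_\alpha^*=\frac{1}{\det\alpha}\sum_{\alpha(\underline{s})=\underline{r}}e(\underline{s}),$$ $\alpha$ acting on $(\mathbb{Q}/\mathbb{Z})^n$ as a matrix. For $\rho\in\mathrm{GL}_n(\hat{\mathbb{Z}})$, the representation $\pi_\rho$ on $\mathcal{H}_n$ with canonical basis $\{\epsilon_\beta\}$ is given by $\mu_\alpha\epsilon_\beta=\epsilon_{\alpha\beta}$ and $\pi_\rho(e(\underline{r}))\epsilon_\beta=\bigl(\prod_{i=1}^n\zeta_i^{\tilde\beta}\bigr)\epsilon_\beta$, where $\zeta=(\zeta_1,\dots,\zeta_n)=\rho(r_1,\ldots,r_n)$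 is the vector of complex roots of unity attached to $\underline r$ via $\rho$, $\tilde\beta$ is the transpose of $\beta$, and $\zeta_i^{\tilde\beta}=\prod_j\zeta_j^{\tilde\beta_{ij}}$. A Hamiltonian for $\sigma$ in $\pi_\rho$ is a self-adjoint positive (possibly unbounded) operator $H$ on $\mathcal{H}_n$ with $\pi_\rho(\sigma_t(a))=e^{itH}\pi_\rho(a)e^{-itH}$ for all $a\in\mathcal{A}_{BC,n}$ and $t\in\mathbb{R}$; it is taken normalized as $H\epsilon_\beta=\log\det(\beta)\,\epsilon_\beta$ (other choices differing by an additive constant).
   Formalization: The given formulas for π_ρ do not satisfy the crossed product relations when n ≥ 2, so π_ρ is not a representation of the algebra; the Hamiltonian is required to implement σ_t on the operators π_ρ(μ_α), π_ρ(e(r)) (and on all of the algebra for any representation with these values). *)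

(* Defs.v *)
From HB Require Import structures.
From mathcomp Require Import all_boot all_order all_algebra.
From mathcomp Require Import all_classical all_reals all_analysis.
From mathcomp Require Import ring_quotient complex.
From mathcomp Require Import ring lra.

Set Implicit Arguments.
Unset Strict Implicit.
Unset Printing Implicit Defensive.

Import Order.TTheory GRing.Theory Num.Theory.
Import numFieldNormedType.Exports.

Local Open Scope classical_set_scope.
Local Open Scope ring_scope.
Local Open Scope quotient_scope.

(* Unital C*-algebras, as complex Banach spaces with a product and a star
   (the product is not the one of GRing.Ring: the hierarchy has no join of the
   ring structures with the normed modules outside of the numeric fields). *)
HB.mixin Record isCStar (R : realType) A of CompleteNormedModule R[i] A := {
  cone : A;
  cmul : A -> A -> A;
  star : A -> A;
  cmulA : associative cmul;
  cmul1x : left_id cone cmul;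
  cmulx1 : right_id cone cmul;
  cmulDl : left_distributive cmul +%R;
  cmulDr : right_distributive cmul +%R;
  cmulZl : forall (c : R[i]) (x y : A), cmul (c *: x) y = c *: cmul x y;
  cmulZr : forall (c : R[i]) (x y : A), cmul x (c *: y) = c *: cmul x y;
  starD : forall x y : A, star (x + y) = star x + star y;
  starZ : forall (c : R[i]) (x : A), star (c *: x) = c^* *: star x;
  starM : forall x y : A, star (cmul x y) = cmul (star y) (star x);
  starK : involutive star;
  cmul_norm : forall x y : A, `|cmul x y| <= `|x| * `|y|;
  star_norm : forall x : A, `|cmul (star x) x| = `|x| ^+ 2 }.

#[short(type="cstarType")]
HB.structure Definition CStar (R : realType) :=
  { A of isCStar R A & CompleteNormedModule R[i] A }.

Notation "x ** y" := (cmul x y) (at level 40, left associativity) : ring_scope.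

Arguments cone {R s}.

Definition star_morphism (R : realType) (A B : cstarType R) (f : A -> B) :=
  [/\ linear f, f cone = cone, {morph f : x y / x ** y}
    & {morph f : x / star x}].

(* A one-parameter group of *-automorphisms, norm continuous in the time
   variable at each element. *)
Definition time_evolution (R : realType) (A : cstarType R)
    (sigma : R -> A -> A) :=
  [/\ forall t, star_morphism (sigma t) /\ bijective (sigma t),
      sigma 0 =1 id,
      forall s t, sigma (s + t) =1 sigma s \o sigma t
    & forall a : A, continuous (fun t : R => sigma t a)].

(* The multiplicative semigroup M_n(Z)^+. *)
Record posmx (n : nat) := PosMx {
  posmx_val :> 'M[int]_n;
  posmx_det : 0 < \det posmx_val }.

HB.instance Definition _ n := [isSub for @posmx_val n].
HB.instance Definition _ n := [Choice of posmx n by <:].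

Lemma posmx_mul_det n (a b : posmx n) : 0 < \det (a *m b).
Proof. by rewrite det_mulmx mulr_gt0 // posmx_det. Qed.

Definition posmx_mul n (a b : posmx n) : posmx n :=
  PosMx (posmx_mul_det a b).

Definition logdet (R : realType) n (a : posmx n) : R := ln ((\det a)%:~R).

Definition QmodZ : Type :=
  Quotient.quot (GRing.ZmodClosed.clone rat (@Num.int_num_subdef rat) _).
HB.instance Definition _ := GRing.Zmodule.on QmodZ.

(* Elements (r_1, ..., r_n) of (Q/Z)^n are row vectors, on which matrices act
   by multiplication on the right. With
     rho_a (e r) = (\det a)^-1 \sum_(act a s = r) e s
   this is the side for which rho_(ab) = rho_a \o rho_b, i.e. for which rho is
   an action of the semigroup M_n(Z)^+; on column vectors one would have
   rho_(ab) = rho_b \o rho_a, incompatibly with mu_(ab) = mu_a mu_b. *)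
Definition act n (a : 'M[int]_n) (r : 'rV[QmodZ]_n) : 'rV[QmodZ]_n :=
  \row_j \sum_i r 0 i *~ a i j.

(* BC_e0, BC_eD and BC_star_e say that e is a unitary representation of the
   group (Q/Z)^n, whose universal C*-algebra is that of Q/Z to the tensor
   power n, with e (r_1, ..., r_n) = e(r_1) (x) ... (x) e(r_n). The index set
   of the sum in BC_covariance is finite, of cardinal \det a. *)
Record BC_relations (R : realType) n (A : cstarType R)
    (e : 'rV[QmodZ]_n -> A) (mu : posmx n -> A) : Prop := {
  BC_e0 : e 0 = cone;
  BC_eD : forall r s, e (r + s) = e r ** e s;
  BC_star_e : forall r, star (e r) = e (- r);
  BC_isometry : forall a, star (mu a) ** mu a = cone;
  BC_muM : forall a b, mu a ** mu b = mu (posmx_mul a b);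
  BC_star_mu : forall a c, star (mu a) ** mu (posmx_mul a c) = mu c;
  BC_covariance : forall a r, mu a ** e r ** star (mu a) =
    ((\det a)%:~R : R[i])^-1 *: \sum_(s \in [set s | act a s = r]) e s }.

(* (A, e, mu) is the semigroup crossed product: the C*-algebra which is
   universal for these generators and relations. *)
Definition is_BC_algebra (R : realType) n (A : cstarType R)
    (e : 'rV[QmodZ]_n -> A) (mu : posmx n -> A) :=
  BC_relations e mu /\
  forall (B : cstarType R) (e' : 'rV[QmodZ]_n -> B) (mu' : posmx n -> B),
    BC_relations e' mu' ->
    exists! f : A -> B,
      [/\ star_morphism f, f \o e =1 e' & f \o mu =1 mu'].

(* exp(i x); in particular det(a)^(i t) = expi (t * logdet a). *)
Definition expi (R : realType) (x : R) : R[i] := Complex (cos x) (sin x).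

Definition BC_evolution (R : realType) n (A : cstarType R)
    (e : 'rV[QmodZ]_n -> A) (mu : posmx n -> A) (sigma : R -> A -> A) :=
  [/\ time_evolution sigma,
      forall t a, sigma t (mu a) = expi (t * logdet R a) *: mu a
    & forall t r, sigma t (e r) = e r].

Section Ell2.
Variables (R : realType) (I : choiceType).

Definition sqnormc (z : R[i]) : R := complex.Re z ^+ 2 + complex.Im z ^+ 2.

Definition square_summable : {pred I -> R[i]} :=
  fun f => (\esum_(i in [set: I]) (sqnormc (f i))%:E < +oo)%E.

Lemma sqnormc_ge0 z : 0 <= sqnormc z.
Proof. by rewrite addr_ge0 ?sqr_ge0. Qed.

Lemma sqnormcM (a b : R[i]) : sqnormc (a * b) = sqnormc a * sqnormc b.
Proof. by case: a b => [ar ai] [br bi]; rewrite /sqnormc /=; ring. Qed.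

Lemma sqnormcD_le (a b : R[i]) :
  sqnormc (a + b) <= 2 * sqnormc a + 2 * sqnormc b.
Proof.
case: a b => [ar ai] [br bi]; rewrite /sqnormc /= -subr_ge0.
rewrite (_ : _ - _ = (ar - br) ^+ 2 + (ai - bi) ^+ 2); last by ring.
by rewrite addr_ge0 ?sqr_ge0.
Qed.

Lemma square_summable_submod : submod_closed square_summable.
Proof.
split.
  rewrite unfold_in /= esum1 ?ltry// => i _.
  by rewrite /sqnormc /= expr0n addr0.
move=> c f g; rewrite !unfold_in => fS gS.
have esumZ_le (k : R) (h : I -> R[i]) : 0 <= k ->
    (\esum_(i in [set: I]) (k * sqnormc (h i))%:E <=
     k%:E * \esum_(i in [set: I]) (sqnormc (h i))%:E)%E.
  move=> k0; apply: ge_ereal_sup => _ [F [finF FI] <-].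
  under eq_fsbigr do rewrite EFinM.
  rewrite -ge0_mule_fsumr//; last by move=> i; rewrite lee_fin sqnormc_ge0.
  apply: lee_wpmul2l; first by rewrite lee_fin.
  by apply: esum_ge; exists F.
pose k := 2 * sqnormc c.
have k0 : 0 <= k by rewrite mulr_ge0 ?sqnormc_ge0.
apply: (@le_lt_trans _ _
  (\esum_(i in [set: I]) ((k * sqnormc (f i))%:E + (2 * sqnormc (g i))%:E))%E).
  apply: le_esum => i _; rewrite -EFinD lee_fin.
  by apply: le_trans (sqnormcD_le _ _) _; rewrite sqnormcM mulrA.
rewrite esumD; do ?by move=> i _; rewrite lee_fin mulr_ge0 ?sqnormc_ge0.
apply: lte_add_pinfty; apply: le_lt_trans (esumZ_le _ _ _) _ => //.
  by rewrite lte_mul_pinfty ?lee_fin ?fin_num_fun.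
by rewrite lte_mul_pinfty ?lee_fin.
Qed.

HB.instance Definition _ := GRing.isSubmodClosed.Build R[i] (I -> R[i])
  square_summable square_summable_submod.

Record ell2 := Ell2 {
  ell2_val :> I -> R[i];
  ell2_prop : ell2_val \in square_summable }.

HB.instance Definition _ := [isSub for ell2_val].
HB.instance Definition _ := [Choice of ell2 by <:].
HB.instance Definition _ := [SubChoice_isSubLmodule of ell2 by <:].

Lemma delta_square_summable (i : I) :
  (fun j => (j == i)%:R : R[i]) \in square_summable.
Proof.
rewrite unfold_in (eq_esum (b := fun j => if j \in [set i] then 1%E else 0%E)).
  by rewrite -esum_mkcond esum_set1 ?ltry ?lee01.
move=> j _; rewrite /sqnormc; have -> : (j \in [set i]) = (j == i).
  by apply/idP/eqP; rewrite inE.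
by case: eqP => _ /=; rewrite ?expr1n ?expr0n ?addr0.
Qed.

Definition delta (i : I) : ell2 := Ell2 (delta_square_summable i).

(* Sum of an absolutely summable family. *)
Definition rsum (h : I -> R) : R :=
  fine (\esum_(i in [set: I]) (EFin \o h)^\+ i -
        \esum_(i in [set: I]) (EFin \o h)^\- i)%E.

Definition csum (h : I -> R[i]) : R[i] :=
  Complex (rsum (fun i => complex.Re (h i))) (rsum (fun i => complex.Im (h i))).

Definition inner (x y : ell2) : R[i] := csum (fun i => (x i)^* * y i).

Definition norm2 (x : ell2) : R :=
  Num.sqrt (fine (\esum_(i in [set: I]) (sqnormc (x i))%:E)).

Definition bounded_operator (T : {linear ell2 -> ell2}) :=
  exists K : R, forall x, norm2 (T x) <= K * norm2 x.

(* Possibly unbounded operators; the values of op outside of dom are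
   irrelevant. *)
Record operator := Operator {
  dom : set ell2;
  op : ell2 -> ell2;
  dom0 : dom 0;
  dom_lin : forall (c : R[i]) x y, dom x -> dom y -> dom (c *: x + y);
  op_lin : forall (c : R[i]) x y, dom x -> dom y ->
    op (c *: x + y) = c *: op x + op y }.

Definition densely_defined (H : operator) :=
  forall x (eps : R), 0 < eps -> exists2 y, dom H y & norm2 (x - y) < eps.

(* y is in the domain of the adjoint of H and is mapped to z by it *)
Definition adjoint_graph (H : operator) (y z : ell2) :=
  forall x, dom H x -> inner (op H x) y = inner x z.

Definition self_adjoint (H : operator) :=
  densely_defined H /\
  forall y z, adjoint_graph H y z <-> dom H y /\ op H y = z.

Definition positive_operator (H : operator) :=
  forall x, dom H x -> 0 <= inner x (op H x).

Definition unitary_group (U : R -> {linear ell2 -> ell2}) :=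
  [/\ forall t x y, inner (U t x) (U t y) = inner x y,
      U 0 =1 id,
      forall s t, U (s + t) =1 U s \o U t
    & forall x, (norm2 (U t x - x) @[t --> (0 : R)] --> (0 : R))].

(* U_t = exp(i t H), by Stone's theorem: U is the one-parameter unitary group
   with infinitesimal generator i H. *)
Definition exp_group (H : operator) (U : R -> {linear ell2 -> ell2}) :=
  unitary_group U /\
  forall x y, (dom H x /\ op H x = y) <->
    (norm2 ((t%:C)%C^-1 *: (U t x - x) - Complex 0 1 *: y)
       @[t --> (0 : R)^'] --> (0 : R)).

Definition op_eigenspace (H : operator) (l : R[i]) : set ell2 :=
  [set x | dom H x /\ op H x = l *: x].

Definition op_eigenvalue (H : operator) (l : R[i]) :=
  exists2 x, op_eigenspace H l x & x != 0.

Definition infinite_dimensional (V : set ell2) :=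
  forall k, exists2 v : 'I_k -> ell2, (forall i, V (v i)) &
    forall c : 'I_k -> R[i], \sum_i c i *: v i = 0 -> forall i, c i = 0.

End Ell2.

Arguments delta {R I}.
Arguments op_eigenvalue {R I}.

(* An element of GL_n(\hat Z) = lim GL_n(Z/m): a compatible family of elements
   of GL_n(Z/m), for m > 1 (gl_at is irrelevant at 0 and 1). *)
Record GLnZhat (n : nat) := GLZhat {
  gl_at : forall m : nat, 'M['Z_m]_n;
  gl_unit : forall m, (1 < m)%N -> gl_at m \in unitmx;
  gl_compat : forall m k, (1 < m)%N -> (0 < k)%N -> (m %| k)%N ->
    map_mx (fun x : 'Z_k => (x : nat)%:R : 'Z_m) (gl_at k) = gl_at m }.

(* A common denominator of the coordinates of r. *)
Definition common_den n (r : 'rV[QmodZ]_n) : nat :=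
  \prod_(j < n) `|denq (repr (r 0%R j))|%N.

(* The action of rho on (Q/Z)^n: on the m-torsion it is that of the component
   of rho in GL_n(Z/m), for every m. *)
Definition gl_act n (rho : GLnZhat n) (r : 'rV[QmodZ]_n) : 'rV[QmodZ]_n :=
  act (map_mx (fun x : 'Z_(common_den r) => (x : nat)%:Z)
         (gl_at rho (common_den r))) r.

(* The root of unity exp(2 i pi q). *)
Definition root_of_unity (R : realType) (q : QmodZ) : R[i] :=
  expi (2 * pi * ratr (repr q)).

Section Representation.
Variables (R : realType) (n : nat).
Notation Hn := (ell2 R (posmx n)).

Definition is_pi_mu (a : posmx n) (T : {linear Hn -> Hn}) :=
  bounded_operator T /\ forall b, T (delta b) = delta (posmx_mul a b).

(* The scalar is prod_i zeta_i^(b^T), where zeta = rho(r) and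
   zeta_i^(b^T) = prod_j zeta_j^((b^T)_ij). *)
Definition is_pi_e (rho : GLnZhat n) (r : 'rV[QmodZ]_n)
    (T : {linear Hn -> Hn}) :=
  bounded_operator T /\
  forall b, T (delta b) =
    (\prod_i \prod_j root_of_unity R (gl_act rho r 0 j) ^ (b^T i j)) *: delta b.

Variables (A : cstarType R) (e : 'rV[QmodZ]_n -> A) (mu : posmx n -> A).

Definition star_representation (pi : A -> {linear Hn -> Hn}) :=
  [/\ forall a, bounded_operator (pi a),
      forall (c : R[i]) a b x, pi (c *: a + b) x = c *: pi a x + pi b x,
      pi cone =1 id,
      forall a b, pi (a ** b) =1 pi a \o pi b
    & forall a x y, inner (pi (star a) x) y = inner x (pi a y)].

Definition is_pi_rho (rho : GLnZhat n) (pi : A -> {linear Hn -> Hn}) :=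
  [/\ star_representation pi,
      forall a, is_pi_mu a (pi (mu a))
    & forall r, is_pi_e rho r (pi (e r))].

(* exp(i t H) implements sigma in the representation pi_rho: on the operators
   by which pi_rho is given, and on all of the algebra. The first two clauses
   are instances of the last one as soon as the formulas of is_pi_rho do define
   a representation; they do not depend on this. *)
Definition implements (rho : GLnZhat n) (sigma : R -> A -> A)
    (U : R -> {linear Hn -> Hn}) :=
  [/\ forall a T, is_pi_mu a T ->
        forall t x, expi (t * logdet R a) *: T x = U t (T (U (- t) x)),
      forall r T, is_pi_e rho r T ->
        forall t x, T x = U t (T (U (- t) x))
    & forall pi, is_pi_rho rho pi ->
        forall t a x, pi (sigma t a) x = U t (pi a (U (- t) x))].

Definition hamiltonian (rho : GLnZhat n) (sigma : R -> A -> A)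
    (H : operator R (posmx n)) :=
  [/\ self_adjoint H, positive_operator H
    & exists2 U, exp_group H U & implements rho sigma U].

End Representation.

Definition normalized (R : realType) n (H : operator R (posmx n)) :=
  forall b, dom H (delta b) /\ op H (delta b) = (logdet R b)%:C%C *: delta b.

(* Main.v *)
Require Import Defs.
From HB Require Import structures.
From mathcomp Require Import all_boot all_order all_algebra.
From mathcomp Require Import all_classical all_reals all_analysis.
From mathcomp Require Import finmap ring_quotient complex.
From mathcomp Require Import ring lra.

Set Implicit Arguments.
Unset Strict Implicit.
Unset Printing Implicit Defensive.

Import Order.TTheory GRing.Theory Num.Theory.
Import numFieldNormedType.Exports.

Local Open Scope classical_set_scope.
Local Open Scope ring_scope.

(** The time evolution. For each [t] the elements [det(a)^(it) mu_a] and [e(r)]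
    satisfy the defining relations again, so by universality there is exactly
    one morphism [sigma_t] with the prescribed values, and the group law follows
    from uniqueness. Continuity in [t] is obtained without estimating [sigma_t]:
    the functions [t |-> det(a)^(it) mu_a] and the constants [e(r)] satisfy the
    relations in the C*-algebra of bounded continuous functions from the reals
    to [A], so that universality yields one morphism [f] to this algebra, whose
    evaluation at [t] is [sigma_t]; hence [t |-> sigma_t(a) = f(a)(t)] is
    continuous ([BC_twisted_functions], [BC_evolution_exists]).

    The Hamiltonian. It is the multiplication by [log det] on its maximal
    domain, and [exp(itH)] is the multiplication by [det^(it)]. Conjugation by
    the latter multiplies [pi(mu_a)] by [det(a)^(it)] and fixes the diagonal
    operators [pi(e(r))]. That it implements [sigma] on all of [A] amounts to
    the fact that two *-representations which agree on the generators are equal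
    ([rep_unique]). The elements at which they agree form a *-subalgebra, which
    is closed because *-representations are contractive ([rep_contractive]), and
    a closed *-subalgebra [D] which contains the generators is the whole of [A]
    ([BC_generated]): universality maps [A] to [D], and the composition with the
    inclusion is the identity by uniqueness. Contractivity reduces to
    self-adjoint elements [h]. If [m > |h|^2] then [1 - h^2 / m] is invertible,
    by a geometric series, so [m - pi(h)^2] is bounded below and [m] is not the
    least constant such that [|pi(h) x|^2 <= m |x|^2].

    The spectrum. Let [H] be any self-adjoint operator with
    [H delta_b = log det(b) delta_b]. Pairing [H x = l x] with [delta_b] gives
    [(log det(b) - l) x_b = 0], so [l] is one of the numbers [log det(b)] as soon
    as [x] is not zero. The eigenspaces are infinite-dimensional because the
    multiplication by unipotent matrices, which exist for [n >= 2], provides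
    infinitely many matrices of a given determinant. *)

(** * Square-summable families *)

Section Ell2Theory.
Variables (R : realType) (I : choiceType).
Local Notation C := R[i].
Local Notation E := (ell2 R I).
Implicit Types (x y : E) (c : C) (i : I).

Lemma conj_complexE c : c^* = Complex (complex.Re c) (- complex.Im c).
Proof. by case: c. Qed.

(** The square of the norm. *)
Definition sq x : R := fine (\esum_(i in [set: I]) (sqnormc (x i))%:E)%E.

Lemma esum_sqE x : (\esum_(i in [set: I]) (sqnormc (x i))%:E = (sq x)%:E)%E.
Proof.
rewrite /sq fineK// fin_numElt; apply/andP; split.
  apply: (lt_le_trans (ltNyr 0)); apply: esum_ge0 => i _.
  by rewrite lee_fin sqnormc_ge0.
by have := ell2_prop x; rewrite unfold_in.
Qed.

Lemma sq_ge0 x : 0 <= sq x.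
Proof. by apply: fine_ge0; apply: esum_ge0 => i _; rewrite lee_fin sqnormc_ge0. Qed.

Lemma norm2E x : norm2 x = Num.sqrt (sq x). Proof. by []. Qed.

Lemma norm2_ge0 x : 0 <= norm2 x. Proof. exact: sqrtr_ge0. Qed.

Lemma norm2_sq x : norm2 x ^+ 2 = sq x.
Proof. by rewrite sqr_sqrtr ?sq_ge0. Qed.

Lemma ell2P x y : (forall i, x i = y i) -> x = y.
Proof. by move=> xy; apply: val_inj; apply/funext => i /=; exact: xy. Qed.

Lemma ell2_addE x y i : (x + y) i = x i + y i. Proof. by []. Qed.
Lemma ell2_oppE x i : (- x) i = - x i. Proof. by []. Qed.
Lemma ell2_scaleE c x i : (c *: x) i = c * x i. Proof. by []. Qed.
Lemma ell2_zeroE i : (0 : E) i = 0. Proof. by []. Qed.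

Lemma ell2_sumE (J : Type) (r : seq J) (f : J -> E) i :
  (\sum_(j <- r) f j) i = \sum_(j <- r) f j i.
Proof.
elim: r => [|j r IH]; first by rewrite !big_nil.
by rewrite !big_cons ell2_addE IH.
Qed.

Lemma sq_le_esum x (w : I -> R) (s : R) :
  (forall i, sqnormc (x i) <= w i) ->
  (\esum_(i in [set: I]) (w i)%:E <= s%:E)%E -> sq x <= s.
Proof.
move=> xw ws; rewrite -lee_fin -esum_sqE; apply: le_trans ws.
by apply: le_esum => i _; rewrite lee_fin.
Qed.

Lemma le_sq x y : (forall i, sqnormc (x i) <= sqnormc (y i)) -> sq x <= sq y.
Proof. by move=> /sq_le_esum; apply; rewrite esum_sqE. Qed.

Lemma square_summable_le (f : I -> C) y :
  (forall i, sqnormc (f i) <= sqnormc (y i)) -> f \in @square_summable R I.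
Proof.
move=> fy; rewrite unfold_in.
apply: (@le_lt_trans _ _ (sq y)%:E); last exact: ltry.
by rewrite -esum_sqE; apply: le_esum => i _; rewrite lee_fin.
Qed.

Lemma sq_coord x i : sqnormc (x i) <= sq x.
Proof.
rewrite -lee_fin -esum_sqE; apply: esum_ge; exists [set i].
  by split => //; exact: finite_set1.
by rewrite fsbig_set1.
Qed.

Lemma sqnormc_eq0 c : sqnormc c = 0 -> c = 0.
Proof.
case: c => a b; rewrite /sqnormc /= => /eqP.
by rewrite paddr_eq0 ?sqr_ge0// !sqrf_eq0 => /andP[/eqP-> /eqP->].
Qed.

Lemma sq_eq0 x : sq x <= 0 -> x = 0.
Proof.
move=> x0; apply: ell2P => i; apply: sqnormc_eq0; apply/le_anti.
by rewrite sqnormc_ge0 andbT (le_trans (sq_coord _ _)).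
Qed.

Lemma esumZ (k : R) (h : I -> R) : 0 <= k -> (forall i, 0 <= h i) ->
  (\esum_(i in [set: I]) (k * h i)%:E =
   k%:E * \esum_(i in [set: I]) (h i)%:E)%E.
Proof.
have le_scale (m : R) (g : I -> R) : 0 <= m -> (forall i, 0 <= g i) ->
    (\esum_(i in [set: I]) (m * g i)%:E <=
     m%:E * \esum_(i in [set: I]) (g i)%:E)%E.
  move=> m0 g0; apply: ge_ereal_sup => _ [F [finF FI] <-].
  under eq_fsbigr do rewrite EFinM.
  rewrite -ge0_mule_fsumr//.
  apply: lee_wpmul2l; first by rewrite lee_fin.
  by apply: esum_ge; exists F.
move=> k0 h0; apply/le_anti; rewrite le_scale //=.
have [->|kN0] := eqVneq k 0.
  by rewrite mul0e; apply: esum_ge0 => i _; rewrite mul0r.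
have k_gt0 : 0 < k by rewrite lt_neqAle eq_sym kN0.
rewrite -lee_pdivlMl//.
have := @le_scale k^-1 (fun i => k * h i).
under eq_esum do rewrite mulKf//.
by apply => [|i]; rewrite ?invr_ge0// mulr_ge0.
Qed.

Lemma sqZ c x : sq (c *: x) = sqnormc c * sq x.
Proof.
apply: EFin_inj; rewrite -esum_sqE EFinM -esum_sqE -esumZ ?sqnormc_ge0//.
  by apply: eq_esum => i _; rewrite ell2_scaleE sqnormcM.
by move=> i; exact: sqnormc_ge0.
Qed.

Lemma sqN x : sq (- x) = sq x.
Proof. by rewrite -scaleN1r sqZ /sqnormc /= oppr0 sqrrN expr1n expr0n addr0 mul1r. Qed.

Lemma sqD_le x y : sq (x + y) <= 2 * sq x + 2 * sq y.
Proof.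
apply: (@sq_le_esum _ (fun i => 2 * sqnormc (x i) + 2 * sqnormc (y i))).
  by move=> i; exact: sqnormcD_le.
under eq_esum do rewrite EFinD.
rewrite esumD; do ?by move=> i _; rewrite lee_fin mulr_ge0 ?sqnormc_ge0.
by rewrite !esumZ ?esum_sqE//; move=> i; exact: sqnormc_ge0.
Qed.

Lemma sqB_le x y : sq (x - y) <= 2 * sq x + 2 * sq y.
Proof. by apply: le_trans (sqD_le _ _) _; rewrite sqN. Qed.

Lemma norm2_le_sq x y (K : R) : norm2 x <= K * norm2 y -> sq x <= K ^+ 2 * sq y.
Proof.
move=> h; rewrite -!norm2_sq -exprMn ler_sqr ?nnegrE ?norm2_ge0//.
exact: le_trans (norm2_ge0 x) h.
Qed.

Lemma bounded_operatorP (T : {linear E -> E}) :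
  bounded_operator T <-> exists2 K : R, 0 <= K & forall x, sq (T x) <= K * sq x.
Proof.
split=> [[K TK]|[K K0 TK]].
  by exists (K ^+ 2); rewrite ?sqr_ge0// => x; exact: norm2_le_sq.
exists (Num.sqrt K) => x.
by rewrite !norm2E -sqrtrM// ler_wsqrtr.
Qed.

(** Tails of a summable family are small. Both the density of the finite
    combinations of the canonical basis and dominated convergence rest on it. *)
Lemma esum_tail (w : I -> R) (s eps : R) : (forall i, 0 <= w i) -> 0 < eps ->
  (\esum_(i in [set: I]) (w i)%:E = s%:E)%E ->
  exists F : {fset I},
    (\esum_(i in [set: I]) (if i \in F then 0 else w i)%:E <= eps%:E)%E.
Proof.
move=> w0 eps0 ws.
have : ((s - eps)%:E < \esum_(i in [set: I]) (w i)%:E)%E.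
  by rewrite ws lte_fin ltrBlDr ltrDl.
move=> /ereal_sup_gt [_ [F [finF _] <-]] ltF.
exists (fset_set F).
have wE : (\esum_(i in [set: I]) (w i)%:E)%E =
   (\esum_(i in [set: I]) (if i \in fset_set F then 0 else w i)%:E +
    \sum_(i \in F) (w i)%:E)%E.
  rewrite -[in RHS]esum_fset//; last by move=> i _; rewrite lee_fin.
  rewrite [X in (_ + X)%E]esum_mkcond -esumD.
  - apply: eq_esum => i _; rewrite in_fset_set//.
    by case: ifPn => _; rewrite ?add0e ?adde0.
  - by move=> i _; rewrite lee_fin; case: ifP.
  - by move=> i _; case: ifP; rewrite ?lee_fin.
move: wE; rewrite ws.
set a := (\esum_(i in _) _)%E; set b := (\sum_(i \in F) _)%E => wE.
have : (0 <= a)%E by apply: esum_ge0 => i _; rewrite lee_fin; case: ifP.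
have : (0 <= b)%E by apply: fsume_ge0 => i _; rewrite lee_fin.
move: ltF wE; rewrite -/b; case: a => [a||]; case: b => [b||]//=.
rewrite -EFinD !lte_fin => ltF [sE] _ _; rewrite lee_fin; lra.
Qed.

Lemma deltaE i j : (delta i : E) j = (j == i)%:R. Proof. by []. Qed.

(** The truncation of [x] to a finite set of indices, written as a combination
    of the canonical basis. *)
Definition truncation (F : {fset I}) x : E := \sum_(i <- F) x i *: delta i.

Lemma truncationE (F : {fset I}) x i :
  truncation F x i = if i \in F then x i else 0.
Proof.
rewrite /truncation ell2_sumE; case: ifPn => iF.
  rewrite (bigD1_seq i) ?fset_uniq//; rewrite ell2_scaleE deltaE eqxx mulr1.
  rewrite big1_seq; first exact: addr0.
  move=> j /andP[ji _].
  by rewrite ell2_scaleE deltaE eq_sym (negPf ji) mulr0.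
rewrite big1_seq// => j /andP[_ jF].
rewrite ell2_scaleE deltaE; case: eqP => [ij|]; last by rewrite mulr0.
by move: iF; rewrite ij jF.
Qed.

Lemma truncation_dense x (eps : R) : 0 < eps ->
  exists F : {fset I}, sq (x - truncation F x) <= eps.
Proof.
move=> eps0.
have [|F FE] := @esum_tail (fun i => sqnormc (x i)) (sq x) eps _ eps0 (esum_sqE x).
  by move=> i; exact: sqnormc_ge0.
exists F; apply: sq_le_esum FE => i.
rewrite ell2_addE ell2_oppE truncationE; case: ifP => _; rewrite ?subr0//.
by rewrite subrr /sqnormc /= expr0n addr0.
Qed.

(** Two bounded operators which agree on the canonical basis are equal. *)
Lemma bounded_eq_delta (T1 T2 : {linear E -> E}) (K : R) :
  (forall x, sq (T1 x) <= K * sq x) -> (forall x, sq (T2 x) <= K * sq x) ->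
  (forall i, T1 (delta i) = T2 (delta i)) -> T1 =1 T2.
Proof.
move=> b1 b2 T12 x.
have TF F : T1 (truncation F x) = T2 (truncation F x).
  rewrite /truncation !linear_sum; apply: eq_bigr => i _.
  by rewrite !linearZ /= T12.
have K0 : 0 <= Num.max K 0 by rewrite le_max lexx orbT.
have bd z : sq (T1 z - T2 z) <= 4 * Num.max K 0 * sq z.
  apply: le_trans (sqB_le _ _) _.
  have h : K * sq z <= Num.max K 0 * sq z.
    by rewrite ler_wpM2r ?sq_ge0// le_max lexx.
  have h1 := le_trans (b1 z) h; have h2 := le_trans (b2 z) h; lra.
apply/eqP; rewrite -subr_eq0; apply/eqP; apply: sq_eq0.
apply/ler_addgt0Pl => eps eps0; rewrite addr0.
have [|F xF] := truncation_dense x (eps := eps / (4 * Num.max K 0 + 1)).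
  by rewrite divr_gt0// ltr_wpDl// mulr_ge0.
rewrite (_ : T1 x - T2 x = T1 (x - truncation F x) - T2 (x - truncation F x)).
  apply: le_trans (bd _) _.
  rewrite ler_pdivlMr in xF; last by rewrite ltr_wpDl// mulr_ge0.
  apply: le_trans xF; rewrite mulrC ler_wpM2l ?sq_ge0//; lra.
by rewrite (linearB T1) (linearB T2) TF opprB addrA subrK.
Qed.

(** The sum of a family can be computed from any decomposition as a difference
    of two summable nonnegative families, and not only from the positive and
    negative parts. *)
Lemma rsumB (f g : I -> R) (a b : R) :
  (forall i, 0 <= f i) -> (forall i, 0 <= g i) ->
  (\esum_(i in [set: I]) (f i)%:E = a%:E)%E ->
  (\esum_(i in [set: I]) (g i)%:E = b%:E)%E ->
  rsum (fun i => f i - g i) = a - b.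
Proof.
move=> f0 g0 fa gb.
have sf : summable [set: I] (EFin \o f).
  rewrite /summable; under eq_esum do rewrite /= ger0_norm//.
  by rewrite fa ltry.
have sg : summable [set: I] (EFin \o g).
  rewrite /summable; under eq_esum do rewrite /= ger0_norm//.
  by rewrite gb ltry.
have := esumB sf sg; rewrite /rsum => h.
rewrite (_ : (EFin \o (fun i => f i - g i)) = ((EFin \o f) \- (EFin \o g))%E)//.
rewrite h; last 2 first.
- by move=> i _; rewrite /= lee_fin.
- by move=> i _; rewrite /= lee_fin.
by rewrite fa gb.
Qed.

(** The real part of the inner product, by polarization. The weight [r] is
    arbitrary; a suitable choice gives the weighted inequality of arithmetic and
    geometric means, which takes the place of the Cauchy-Schwarz inequality. *)
Lemma Re_innerE (r : R) x y : 0 < r -> complex.Re (inner x y) =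
  (sq x + r ^+ 2 * sq y - sq (x - r%:C%C *: y)) / (2 * r).
Proof.
move=> r0; rewrite /inner /csum /=.
have k0 : 0 <= (2 * r)^-1 by rewrite invr_ge0 mulr_ge0// ltW.
have e (k : R) (z : E) : 0 <= k ->
    (\esum_(i in [set: I]) (k * sqnormc (z i))%:E = (k * sq z)%:E)%E.
  by move=> ?; rewrite esumZ ?esum_sqE// => i; exact: sqnormc_ge0.
have k1 : 0 <= (2 * r)^-1 * r ^+ 2 by rewrite mulr_ge0 ?sqr_ge0.
rewrite (_ : (fun i => _) = (fun i =>
   ((2 * r)^-1 * sqnormc (x i) + (2 * r)^-1 * r ^+ 2 * sqnormc (y i))
   - (2 * r)^-1 * sqnormc ((x - r%:C%C *: y) i))).
  rewrite (@rsumB _ _ ((2 * r)^-1 * sq x + (2 * r)^-1 * r ^+ 2 * sq y)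
                      ((2 * r)^-1 * sq (x - r%:C%C *: y))).
  - by field; rewrite gt_eqF.
  - by move=> i; rewrite addr_ge0// mulr_ge0 ?sqnormc_ge0.
  - by move=> i; rewrite mulr_ge0 ?sqnormc_ge0.
  - under eq_esum do rewrite EFinD.
    by rewrite esumD ?e//; move=> i _; rewrite lee_fin mulr_ge0 ?sqnormc_ge0.
  - exact: e.
apply/funext => i; rewrite conj_complexE ell2_addE ell2_oppE ell2_scaleE /sqnormc.
by case: (x i) (y i) => [a b] [c d] /=; field; rewrite gt_eqF.
Qed.

Lemma rsum_supp1 (h : I -> R) i : (forall j, j != i -> h j = 0) -> rsum h = h i.
Proof.
move=> hi; rewrite /rsum.
have e (g : I -> \bar R) : (forall j, 0 <= g j)%E ->
    (forall j, j != i -> g j = 0%E) -> (\esum_(j in [set: I]) g j = g i)%E.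
  move=> g0 gi.
  rewrite -[RHS](@esum_set1 _ _ i)// [RHS]esum_mkcond; apply: eq_esum => j _.
  case: ifPn => //; rewrite notin_setE /= => /eqP/gi; exact.
rewrite !e//.
- by have := congr1 (@^~ i) (funeposneg (EFin \o h)) => /= <-.
- by move=> j /hi; rewrite funenegE /= => ->; rewrite oppr0 maxxx.
- by move=> j /hi; rewrite funeposE /= => ->; rewrite maxxx.
Qed.

Lemma inner_Zdelta c i x : inner (c *: delta i) x = c^* * x i.
Proof.
rewrite /inner /csum (@rsum_supp1 _ i) ?(@rsum_supp1 _ i).
- by rewrite ell2_scaleE deltaE eqxx mulr1; case: (_ * _).
- by move=> j /negPf ji; rewrite ell2_scaleE deltaE ji mulr0 conjC0 mul0r.
- by move=> j /negPf ji; rewrite ell2_scaleE deltaE ji mulr0 conjC0 mul0r.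
Qed.

Lemma inner_delta i x : inner (delta i) x = x i.
Proof. by rewrite -[delta i]scale1r inner_Zdelta conj_complexE /= oppr0 mul1r. Qed.

Lemma sq0 : sq (0 : E) = 0.
Proof. by rewrite -(scale0r (0 : E)) sqZ /sqnormc /= expr0n addr0 mul0r. Qed.

Lemma Re_inner_self x : complex.Re (inner x x) = sq x.
Proof. by rewrite (@Re_innerE 1)// scale1r subrr sq0; lra. Qed.

End Ell2Theory.

(** * Multiplication by a real function on square-summable families *)

Section Expi.
Variable R : realType.
Implicit Types (s t u : R) (c : R[i]).

Lemma expi0 : expi (0 : R) = 1.
Proof. by rewrite /expi cos0 sin0. Qed.

Lemma expiD s t : expi (s + t) = expi s * expi t.
Proof. by rewrite /expi sinD cosD; congr (Complex _ _); rewrite addrC. Qed.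

Lemma conj_expi t : (expi t)^* = expi (- t).
Proof. by rewrite conj_complexE /expi /= cosN sinN. Qed.

Lemma expi_conjM t : (expi t)^* * expi t = 1.
Proof. by rewrite conj_expi -expiD addNr expi0. Qed.

Lemma sqnormc_expi t : sqnormc (expi t) = 1.
Proof. by rewrite /sqnormc /= cos2Dsin2. Qed.

Lemma sqnormc_expiM t c : sqnormc (expi t * c) = sqnormc c.
Proof. by rewrite sqnormcM sqnormc_expi mul1r. Qed.

Lemma sin_sqr_le u : sin u ^+ 2 <= u ^+ 2.
Proof.
wlog u0 : u / 0 <= u.
  move=> h; have [/h//|/ltW u0] := leP 0 u.
  by rewrite -[in leLHS](opprK u) sinN !sqrrN -[leRHS]sqrrN h// oppr_ge0.
have [u1|u1] := leP 1 u.
  have := sin2cos2 u; have := sqr_ge0 (cos u) => h1 h2.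
  have : 1 <= u ^+ 2 by rewrite exprn_ege1.
  lra.
have [->|uN0] := eqVneq u 0; first by rewrite sin0 expr0n.
have u_gt0 : 0 < u by rewrite lt_neqAle eq_sym uN0.
have [c _] := @MVT R sin cos 0 u u_gt0 (fun x _ => is_derive_sin x)
  (continuous_subspaceT (@continuous_sin R)).
rewrite sin0 !subr0 => ->.
by rewrite exprMn ler_piMl ?sqr_ge0// -(cos2Dsin2 c) lerDl sqr_ge0.
Qed.

Lemma cos_half u : cos u = 1 - 2 * sin (u / 2) ^+ 2.
Proof.
have := cosD (u / 2) (u / 2); rewrite -splitr => ->.
by have := cos2sin2 (u / 2); rewrite !expr2; lra.
Qed.

Lemma sqnormc_expiB1 t : sqnormc (expi t - 1) <= t ^+ 2.
Proof.
have -> : sqnormc (expi t - 1) = 4 * sin (t / 2) ^+ 2.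
  rewrite /sqnormc /= oppr0 addr0.
  have := cos2sin2 t; have := cos_half t; rewrite !expr2; nra.
have := sin_sqr_le (t / 2); rewrite exprMn; lra.
Qed.

Lemma cos_ge u : 1 - u ^+ 2 / 2 <= cos u.
Proof. by have := sin_sqr_le (u / 2); rewrite cos_half exprMn; lra. Qed.

(** The square norm on the left has derivative [2 * u * (1 - cos u)]. *)
Lemma sqnormc_expi_taylor u : sqnormc (expi u - 1 - Complex 0 u) <= u ^+ 4.
Proof.
pose g : R -> R := (cos - cst 1) ^+ 2 + (sin - id) ^+ 2.
have gE v : sqnormc (expi v - 1 - Complex 0 v) = g v.
  by rewrite /sqnormc /g /= oppr0 !addr0.
wlog u0 : u / 0 < u.
  move=> h; have [u0|u0|<-] := ltrgtP 0 u; first exact: h.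
    have := h (- u); rewrite oppr_gt0 => /(_ u0).
    by rewrite !gE /g !fctE cosN sinN -opprD sqrrN exprNn -signr_odd expr0 mul1r.
  by rewrite gE /g !fctE cos0 sin0 !subrr !expr0n addr0.
have dg v : is_derive v (1 : R) g (2 * v * (1 - cos v)).
  have d1 : is_derive v (1 : R) (cos - cst 1) (- sin v - 0) by apply: is_deriveB.
  have d2 : is_derive v (1 : R) (sin - id) (cos v - 1) by apply: is_deriveB.
  apply: (is_derive_eq (is_deriveD (is_deriveX 2 d1) (is_deriveX 2 d2))).
  rewrite /GRing.scale /= !fctE; ring.
have cg : {within `[0, u], continuous g}.
  apply: continuous_subspaceT => v.
  by apply/differentiable_continuous/derivable1_diffP; exact: (@ex_derive _ _ _ _ _ _ _ (dg v)).
have [c] := MVT u0 (fun v _ => dg v) cg.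
rewrite in_itv /= => /andP[c0 cu].
have -> : g 0 = 0 by rewrite /g !fctE cos0 sin0 !subrr !expr0n addr0.
rewrite !subr0 gE => ->.
have hc : 1 - cos c <= c ^+ 2 / 2 by have := cos_ge c; lra.
have hc0 : 0 <= 1 - cos c by rewrite subr_ge0 cos_le1.
have : c * (1 - cos c) <= u * (u ^+ 2 / 2).
  apply: ler_pM => //; [exact: ltW|exact: ltW|].
  apply: le_trans hc _; rewrite ler_pM2r ?invr_gt0//.
  by rewrite ler_sqr ?nnegrE ?ltW.
rewrite -(ler_pM2r u0) => h; rewrite !exprS expr0 in h *; nra.
Qed.

(** The derivative of [expi (t * u)] at [t = 0] is [Complex 0 u], with an explicit
    rate of convergence. *)
Lemma expi_quotient t u : t != 0 ->
  sqnormc ((t%:C)%C^-1 * (expi (t * u) - 1) - Complex 0 u) <= t ^+ 2 * u ^+ 4.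
Proof.
move=> t0.
have tC : ((t%:C)%C)^-1 = (t^-1%:C)%C :> R[i] by rewrite fmorphV.
have -> : (t%:C)%C^-1 * (expi (t * u) - 1) - Complex 0 u =
    (t^-1%:C)%C * (expi (t * u) - 1 - Complex 0 (t * u)).
  rewrite tC [RHS]mulrBr; congr (_ - _).
  by apply/eqP; rewrite eq_complex /= !mulr0 mul0r subr0 addr0 mulKf// !eqxx.
rewrite sqnormcM (_ : sqnormc (t^-1%:C)%C = (t ^+ 2)^-1); last first.
  by rewrite /sqnormc /= expr0n addr0 exprVn.
rewrite mulrC ler_pdivrMr ?exprn_even_gt0//.
by apply: le_trans (sqnormc_expi_taylor _) _; rewrite exprMn; lra.
Qed.

Lemma expi_quotient_bounded t u : t != 0 ->
  sqnormc ((t%:C)%C^-1 * (expi (t * u) - 1) - Complex 0 u) <= 4 * u ^+ 2.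
Proof.
move=> t0; apply: le_trans (sqnormcD_le _ _) _.
rewrite sqnormcM.
have -> : sqnormc (((t%:C)%C)^-1 : R[i]) = (t ^+ 2)^-1.
  by rewrite -fmorphV /sqnormc /= expr0n addr0 exprVn.
have -> : sqnormc (- (Complex 0 u)) = u ^+ 2.
  by rewrite /sqnormc /= oppr0 expr0n add0r sqrrN.
have : (t ^+ 2)^-1 * sqnormc (expi (t * u) - 1) <= u ^+ 2.
  rewrite mulrC ler_pdivrMr ?exprn_even_gt0//.
  by apply: le_trans (sqnormc_expiB1 _) _; rewrite exprMn mulrC.
lra.
Qed.

End Expi.

Section Norm2Limits.
Variables (R : realType) (I : choiceType).
Local Notation E := (ell2 R I).

Lemma cvg_norm2P (F : set_system R) (FF : Filter F) (z : R -> E) :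
  (norm2 (z t) @[t --> F] --> (0 : R)) <->
  forall eps, 0 < eps -> \forall t \near F, sq (z t) <= eps.
Proof.
split=> [/cvgr0Pnorm_lt zF eps eps0|zF].
  have := zF (Num.sqrt eps); rewrite sqrtr_gt0 => /(_ eps0).
  apply: filterS => t; rewrite ger0_norm ?norm2_ge0// /norm2 ltr_sqrt//.
  exact: ltW.
apply/cvgr0Pnorm_lt => eps eps0.
have /zF : 0 < (eps / 2) ^+ 2 by rewrite exprn_gt0// divr_gt0.
apply: filterS => t zt; rewrite ger0_norm ?norm2_ge0//.
apply: (@le_lt_trans _ _ (eps / 2)); last by lra.
by rewrite -(@ler_sqr _ (norm2 _)) ?nnegrE ?norm2_ge0 ?norm2_sq//; lra.
Qed.

Lemma near0_sqr (K eps : R) : 0 <= K -> 0 < eps ->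
  \forall t \near (0 : R), t ^+ 2 * K <= eps.
Proof.
move=> K0 eps0.
have d0 : 0 < Num.sqrt (eps / (K + 1)).
  by rewrite sqrtr_gt0 divr_gt0// ltr_wpDl.
near=> t.
have : t ^+ 2 <= eps / (K + 1).
  have : `|t| <= Num.sqrt (eps / (K + 1)).
    by near: t; exact: (@nbhs0_le _ R^o).
  rewrite -(@ler_sqr _ `|t|) ?nnegrE ?sqrtr_ge0// real_normK ?num_real//.
  by rewrite sqr_sqrtr// ltW// -sqrtr_gt0.
rewrite ler_pdivlMr ?ltr_wpDl// => h.
have := sqr_ge0 t; lra.
Unshelve. all: by end_near. Qed.

(** Dominated convergence as [t] tends to [0] along [P], for a dominating family
    [w] and coordinates whose square norms are [O(t ^+ 2)], not uniformly. *)
Lemma dominated_norm2 (P : R -> Prop) (z : R -> E) (w k : I -> R) (s : R) :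
  (\esum_(i in [set: I]) (w i)%:E = s%:E)%E ->
  (forall i, 0 <= w i) -> (forall i, 0 <= k i) ->
  (forall t, P t -> forall i, sqnormc (z t i) <= w i) ->
  (forall t, P t -> forall i, sqnormc (z t i) <= t ^+ 2 * k i) ->
  forall eps, 0 < eps -> \forall t \near (0 : R), P t -> sq (z t) <= eps.
Proof.
move=> ws w0 k0 zw zk eps eps0.
have [|F FE] := esum_tail w0 _ ws (eps := eps / 2); first by lra.
pose K := \sum_(i <- F) k i.
have K0 : 0 <= K by apply: sumr_ge0.
have dle t : P t -> sq (z t) <= eps / 2 + t ^+ 2 * K.
  move=> Pt; rewrite -lee_fin -esum_sqE EFinD.
  pose g i := if i \in F then t ^+ 2 * k i else 0.
  apply: (@le_trans _ _ (\esum_(i in [set: I])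
     ((if i \in F then 0 else w i)%:E + (g i)%:E))%E).
    apply: le_esum => i _; rewrite -EFinD lee_fin /g.
    by case: ifP => _; rewrite ?add0r ?addr0; [exact: zk|exact: zw].
  rewrite esumD; last 2 first.
  - by move=> i _; rewrite lee_fin; case: ifP.
  - by move=> i _; rewrite lee_fin /g; case: ifP => // _; rewrite mulr_ge0 ?sqr_ge0.
  apply: leeD => //.
  have -> : (\esum_(i in [set: I]) (g i)%:E =
             \esum_(i in [set` F]) (t ^+ 2 * k i)%:E)%E.
    rewrite [RHS]esum_mkcond; apply: eq_esum => i _; rewrite /g.
    by rewrite mem_setE; case: ifP.
  rewrite esum_fset//; last first.
    by move=> i _; rewrite lee_fin mulr_ge0 ?sqr_ge0.
  rewrite fsbig_finite//= set_fsetK sumEFin lee_fin /K mulr_sumr.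
  by rewrite le_eqVlt eqxx.
apply: filterS (near0_sqr K0 (_ : 0 < eps / 2)); last by lra.
move=> t tK Pt; apply: le_trans (dle _ Pt) _; lra.
Qed.

End Norm2Limits.

Section Multiplication.
Variables (R : realType) (I : choiceType) (l : I -> R).
Local Notation C := R[i].
Local Notation E := (ell2 R I).
Implicit Types (x y z : E) (t : R).

Lemma phase_subproof t x :
  (fun i => expi (t * l i) * x i) \in @square_summable R I.
Proof. by apply: (@square_summable_le _ _ _ x) => i; rewrite sqnormc_expiM. Qed.

(** The unitary operator of multiplication by [expi (t * l i)]. *)
Definition phase t x : E := Ell2 (phase_subproof t x).

Lemma phaseE t x i : phase t x i = expi (t * l i) * x i. Proof. by []. Qed.

Lemma phase_is_linear t : linear (phase t).
Proof.
move=> c x y; apply: ell2P => i.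
by rewrite !(phaseE, ell2_addE, ell2_scaleE) mulrDr mulrCA.
Qed.

HB.instance Definition _ t :=
  GRing.isLinear.Build C E E _ (phase t) (phase_is_linear t).

Lemma sq_phase t x : sq (phase t x) = sq x.
Proof. by apply/le_anti/andP; split; apply: le_sq => i; rewrite phaseE sqnormc_expiM. Qed.

Lemma phase0 x : phase 0 x = x.
Proof. by apply: ell2P => i; rewrite phaseE mul0r expi0 mul1r. Qed.

Lemma phaseD s t x : phase (s + t) x = phase s (phase t x).
Proof. by apply: ell2P => i; rewrite !phaseE mulrDl expiD mulrA. Qed.

Lemma phase_delta t i : phase t (delta i) = expi (t * l i) *: delta i.
Proof.
apply: ell2P => j; rewrite phaseE ell2_scaleE deltaE.
by case: eqP => [->//|_]; rewrite !mulr0.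
Qed.

Lemma inner_phase t x y : inner (phase t x) y = inner x (phase (- t) y).
Proof.
rewrite /inner; congr csum; apply/funext => i.
by rewrite !phaseE rmorphM /= conj_expi mulNr mulrCA mulrA.
Qed.

Definition lmul_fun x i : C := (l i)%:C%C * x i.

(** The maximal domain of the multiplication by [l]. *)
Definition lmul_dom : set E := [set x | lmul_fun x \in @square_summable R I].

(** The multiplication by [l], with value [0] outside of its domain. *)
Definition lmul x : E := insubd 0 (lmul_fun x).

Lemma lmulE x i : lmul_dom x -> lmul x i = (l i)%:C%C * x i.
Proof. by move=> Dx; rewrite /lmul /insubd insubT. Qed.

Lemma lmulP x y : (forall i, (l i)%:C%C * x i = y i) -> lmul_dom x /\ lmul x = y.
Proof.
move=> xy; have Dx : lmul_dom x.
  rewrite /lmul_dom /= (_ : lmul_fun x = y) ?ell2_prop//.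
  by apply/funext => i; exact: xy.
by split=> //; apply: ell2P => i; rewrite lmulE.
Qed.

Lemma lmul0 : lmul_dom 0 /\ lmul 0 = 0.
Proof. by apply: lmulP => i; rewrite ell2_zeroE mulr0. Qed.

Lemma lmul_lin (c : C) x y : lmul_dom x -> lmul_dom y ->
  lmul_dom (c *: x + y) /\ lmul (c *: x + y) = c *: lmul x + lmul y.
Proof.
move=> Dx Dy; apply: lmulP => i.
by rewrite !(ell2_addE, ell2_scaleE) !lmulE// mulrDr mulrCA.
Qed.

Definition lmul_operator : operator R I :=
  Operator (proj1 lmul0) (fun c x y Dx Dy => proj1 (lmul_lin c Dx Dy))
           (fun c x y Dx Dy => proj2 (lmul_lin c Dx Dy)).

Lemma lmul_delta i : lmul_dom (delta i) /\ lmul (delta i) = (l i)%:C%C *: delta i.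
Proof.
apply: lmulP => j; rewrite ell2_scaleE deltaE.
by case: eqP => [->//|_]; rewrite !mulr0.
Qed.

Lemma lmul_self_adjoint : self_adjoint lmul_operator.
Proof.
split=> [x eps eps0|y z].
  have [|F xF] := truncation_dense x (eps := (eps / 2) ^+ 2).
    by rewrite exprn_gt0// divr_gt0.
  exists (truncation F x); last first.
    apply: (@le_lt_trans _ _ (eps / 2)); last by lra.
    by rewrite -(@ler_sqr _ (norm2 _)) ?nnegrE ?norm2_ge0 ?norm2_sq//; lra.
  have [|D _] := @lmulP (truncation F x)
    (\sum_(i <- F) ((l i)%:C%C * x i) *: delta i) => //.
  move=> i; rewrite /truncation !ell2_sumE mulr_sumr; apply: eq_bigr => j _.
  rewrite !ell2_scaleE !deltaE; case: eqP => [->|_]; last by rewrite !mulr0.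
  by rewrite !mulr1.
split=> [adj|[Dy <-] x Dx] /=.
  (* Tested on [delta i], the adjoint relation reads [l i * y i = z i]. *)
  apply: lmulP => i.
  have [Di lE] := lmul_delta i.
  have := adj _ Di; rewrite /= lE inner_delta => <-.
  by rewrite inner_Zdelta conj_complexE /= oppr0.
rewrite /inner; congr csum; apply/funext => i.
rewrite (lmulE i Dx) (lmulE i Dy) !conj_complexE.
case: (x i) (y i) => [a b] [c d]; apply/eqP; rewrite eq_complex /=.
by apply/andP; split; apply/eqP; ring.
Qed.

Lemma rsum_ge0 (h : I -> R) : (forall i, 0 <= h i) -> 0 <= rsum h.
Proof.
move=> h0; rewrite /rsum [X in (_ - X)%E]esum1 ?sube0; last first.
  by move=> i _; rewrite funenegE /= max_r// lee_fin oppr_le0.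
by apply: fine_ge0; apply: esum_ge0 => i _; rewrite funeposE le_max lexx orbT.
Qed.

Lemma lmul_positive : (forall i, 0 <= l i) -> positive_operator lmul_operator.
Proof.
move=> l_ge0 x Dx; rewrite lecE /= /inner /csum /=; apply/andP; split.
  rewrite (_ : (fun i => _) = fun=> 0); last first.
    apply/funext => i; rewrite lmulE// conj_complexE; case: (x i) => a b /=; ring.
  by apply/eqP; rewrite /rsum !esum1 ?sube0// => i _; rewrite ?funeposE ?funenegE /= ?oppr0 maxxx.
apply: rsum_ge0 => i.
rewrite lmulE// conj_complexE; case: (x i) => a b /=.
rewrite (_ : _ - _ = l i * (a ^+ 2 + b ^+ 2)); last by ring.
by rewrite mulr_ge0// addr_ge0 ?sqr_ge0.
Qed.

Lemma phase_unitary_group : unitary_group (fun t => phase t : {linear E -> E}).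
Proof.
split=> [t x y||s t|x].
- by rewrite inner_phase -phaseD addNr phase0.
- exact: phase0.
- exact: phaseD.
apply/cvg_norm2P => eps eps0.
have := @dominated_norm2 R I (fun=> True) (fun t => phase t x - x)
  (fun i => 4 * sqnormc (x i)) (fun i => l i ^+ 2 * sqnormc (x i)) (4 * sq x).
move=> /(_ _ _ _ _ _ _ eps0) h.
have {}h : \forall t \near (0 : R), True -> sq (phase t x - x) <= eps.
  apply: h.
  - by rewrite esumZ ?esum_sqE// => i; exact: sqnormc_ge0.
  - by move=> i; rewrite mulr_ge0 ?sqnormc_ge0.
  - by move=> i; rewrite mulr_ge0 ?sqr_ge0 ?sqnormc_ge0.
  - move=> t _ i; rewrite ell2_addE ell2_oppE; apply: le_trans (sqnormcD_le _ _) _.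
    rewrite phaseE sqnormc_expiM; case: (x i) => a b; rewrite /sqnormc /= !sqrrN; lra.
  move=> t _ i; rewrite ell2_addE ell2_oppE phaseE -{2}[x i]mul1r -mulrBl.
  rewrite sqnormcM mulrA -exprMn ler_wpM2r ?sqnormc_ge0//.
  exact: sqnormc_expiB1.
by apply: filterS h => t; exact.
Qed.

(* It tends to [0] with [t] exactly when [x] is in the domain and [y = lmul x]. *)
Let quotient (t : R) (x y : E) : E :=
  (t%:C)%C^-1 *: (phase t x - x) - Complex 0 1 *: y.

Lemma quotientE t x i : lmul_dom x ->
  quotient t x (lmul x) i =
  ((t%:C)%C^-1 * (expi (t * l i) - 1) - Complex 0 (l i)) * x i.
Proof.
move=> Dx; rewrite /quotient !(ell2_addE, ell2_oppE, ell2_scaleE) phaseE lmulE//.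
rewrite [RHS]mulrBl -mulrA [in RHS]mulrBl mul1r; congr (_ - _).
rewrite mulrA; congr (_ * _).
by apply/eqP; rewrite eq_complex /=; apply/andP; split; apply/eqP; ring.
Qed.

Lemma quotient_cvg x : lmul_dom x ->
  forall eps, 0 < eps -> \forall t \near (0 : R), t != 0 ->
    sq (quotient t x (lmul x)) <= eps.
Proof.
move=> Dx eps.
apply: (@dominated_norm2 R I (fun t => t != 0) _
  (fun i => 4 * sqnormc (lmul x i))
  (fun i => l i ^+ 4 * sqnormc (x i)) (4 * sq (lmul x))).
- by rewrite esumZ ?esum_sqE// => i; exact: sqnormc_ge0.
- by move=> i; rewrite mulr_ge0 ?sqnormc_ge0.
- by move=> i; rewrite mulr_ge0 ?exprn_even_ge0 ?sqnormc_ge0.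
- move=> t t0 i.
  rewrite quotientE// sqnormcM lmulE// sqnormcM mulrA ler_wpM2r ?sqnormc_ge0//.
  apply: le_trans (expi_quotient_bounded _ t0) _.
  by rewrite /sqnormc /= expr0n addr0.
- move=> t t0 i.
  rewrite quotientE// sqnormcM mulrA ler_wpM2r ?sqnormc_ge0//.
  exact: expi_quotient.
Qed.

Lemma lmul_exp_group :
  exp_group lmul_operator (fun t => phase t : {linear E -> E}).
Proof.
split=> [|x y]; first exact: phase_unitary_group.
split=> [[Dx <-]|].
  apply/cvg_norm2P => eps eps0.
  have := quotient_cvg Dx eps0.
  by rewrite near_withinE.
move=> /cvg_norm2P xy; apply: lmulP => i.
apply/eqP; rewrite -subr_eq0; apply/eqP; apply: sqnormc_eq0; apply/le_anti.
rewrite sqnormc_ge0 andbT; apply/ler_addgt0Pl => eps eps0; rewrite addr0.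
(* The coordinate [i] of [quotient t x y] is [G t + Complex 0 1 * D]. It tends to
   [0] and so does [G t], while [D] does not depend on [t]. *)
set D := _ - y i.
pose G t := ((t%:C)%C^-1 * (expi (t * l i) - 1) - Complex 0 (l i)) * x i.
have qE t : quotient t x y i = G t + Complex 0 1 * D.
  rewrite /quotient /G /D !(ell2_addE, ell2_oppE, ell2_scaleE) phaseE.
  have -> : Complex 0 (l i) = Complex 0 1 * (l i)%:C%C.
    by apply/eqP; rewrite eq_complex /=; apply/andP; split; apply/eqP; ring.
  by ring.
have DE t : sqnormc D <= 2 * sqnormc (quotient t x y i) + 2 * sqnormc (G t).
  have -> : sqnormc D = sqnormc (quotient t x y i - G t).
    by rewrite qE addrAC subrr add0r sqnormcM /sqnormc /= expr0n expr1n add0r mul1r.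
  apply: le_trans (sqnormcD_le _ _) _.
  by rewrite -mulN1r sqnormcM {2}/sqnormc /= oppr0 sqrrN expr1n expr0n addr0 mul1r.
have K0 : 0 <= l i ^+ 4 * sqnormc (x i).
  by rewrite mulr_ge0 ?exprn_even_ge0 ?sqnormc_ge0.
have e4 : 0 < eps / 4 by lra.
have near1 := xy _ e4.
have near2 := near0_sqr K0 e4.
have [t [qt Kt t0]] : exists t, [/\ sq (quotient t x y) <= eps / 4,
    t ^+ 2 * (l i ^+ 4 * sqnormc (x i)) <= eps / 4 & t != 0].
  apply: (@filter_ex _ (0 : R)^'); near=> t; split.
  - near: t; exact: near1.
  - near: t; exact: nbhs_dnbhs near2.
  - near: t; exact: nbhs_dnbhs_neq.
have h1 := le_trans (sq_coord (quotient t x y) i) qt.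
have h2 : sqnormc (G t) <= eps / 4.
  apply: le_trans Kt; rewrite /G sqnormcM mulrA ler_wpM2r ?sqnormc_ge0//.
  exact: expi_quotient.
have := DE t; lra.
Unshelve. all: by end_near. Qed.

End Multiplication.

(** * C*-algebras of bounded functions *)

Section RealNorm.
Variables (R : realType) (A : cstarType R).
Implicit Types (a b : A).

(** The norm of a C*-algebra, as a real number. *)
Definition nrm a : R := complex.Re `|a|.

Lemma nrmE a : `|a| = (nrm a)%:C%C.
Proof.
have /ger0_Im : 0 <= `|a| by [].
by rewrite /nrm; case: `|a| => x y /= ->.
Qed.

Lemma nrm_ge0 a : 0 <= nrm a. Proof. by rewrite -ler0c -nrmE. Qed.

Lemma nrmD a b : nrm (a + b) <= nrm a + nrm b.
Proof. by rewrite -lecR rmorphD /= -!nrmE ler_normD. Qed.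

Lemma nrmN a : nrm (- a) = nrm a. Proof. by rewrite /nrm normrN. Qed.

Lemma nrmB a b : nrm (a - b) <= nrm a + nrm b.
Proof. by apply: le_trans (nrmD _ _) _; rewrite nrmN. Qed.

Lemma nrm_distC a b : nrm (a - b) = nrm (b - a).
Proof. by rewrite -nrmN opprB. Qed.

Lemma nrmZ (c : R[i]) a : nrm (c *: a) = complex.Re `|c| * nrm a.
Proof. by rewrite {1}/nrm normrZ nrmE normc_def /= mul0r subr0. Qed.

Lemma nrm_eq0 a : nrm a = 0 -> a = 0.
Proof. by move=> a0; apply/normr0_eq0; rewrite nrmE a0. Qed.

Lemma nrm0 : nrm (0 : A) = 0. Proof. by rewrite /nrm normr0. Qed.

Lemma nrmM a b : nrm (a ** b) <= nrm a * nrm b.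
Proof. by rewrite -lecR rmorphM /= -!nrmE cmul_norm. Qed.

Lemma cmulNl a b : - a ** b = - (a ** b).
Proof. by have := cmulZl (-1) a b; rewrite !scaleN1r. Qed.

Lemma cmulNr a b : a ** - b = - (a ** b).
Proof. by have := cmulZr (-1) a b; rewrite !scaleN1r. Qed.

Lemma starN a : star (- a) = - star a.
Proof. by have := starZ (-1) a; rewrite conjCN1 !scaleN1r. Qed.

Lemma star_morphismZ (B : cstarType R) (f : A -> B) (c : R[i]) a :
  star_morphism f -> f (c *: a) = c *: f a.
Proof.
move=> [fl _ _ _]; have f0 : f 0 = 0.
  by have := fl (-1) 0 0; rewrite scaleN1r addNr scaleN1r addNr.
by have := fl c a 0; rewrite f0 !addr0.
Qed.

Lemma nrm_star_mul a : nrm (star a ** a) = nrm a ^+ 2.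
Proof. by apply: (@complexI R); rewrite rmorphXn /= -!nrmE star_norm. Qed.

Lemma nrm_star a : nrm (star a) = nrm a.
Proof.
have le b : nrm b <= nrm (star b).
  have [->|b0] := eqVneq (nrm b) 0; first exact: nrm_ge0.
  have := nrmM (star b) b; rewrite nrm_star_mul expr2 ler_pM2r//.
  by rewrite lt_neqAle eq_sym b0 nrm_ge0.
by apply/le_anti; rewrite le andbT -[leRHS](congr1 nrm (starK a)).
Qed.

End RealNorm.

(** A set of functions on [X] with values in [A] which is a unital
   *-subalgebra, closed for the uniform convergence. *)
Record uniform_subalgebra (R : realType) (X : Type) (A : cstarType R) := {
  usub :> (X -> A) -> Prop;
  usub1 : usub (fun=> cone);
  usub_lin : forall (c : R[i]) f g, usub f -> usub g ->
    usub (fun x => c *: f x + g x);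
  usubM : forall f g, usub f -> usub g -> usub (fun x => f x ** g x);
  usub_star : forall f, usub f -> usub (fun x => star (f x));
  usub_closed : forall g, (forall eps : R, 0 < eps ->
      exists2 f, usub f & forall x, nrm (f x - g x) <= eps) -> usub g }.

Section BoundedFunctions.
Variables (R : realType) (X : pointedType) (A : cstarType R).
Variable S : uniform_subalgebra X A.
Local Notation C := R[i].

Definition bounded_member : {pred X -> A} :=
  fun f => `[< S f /\ exists M : R, forall x, nrm (f x) <= M >].

Lemma bounded_memberP f :
  reflect (S f /\ exists M : R, forall x, nrm (f x) <= M) (f \in bounded_member).
Proof. exact: asboolP. Qed.

Lemma usub0 : S (fun=> 0).
Proof.
have := usub_lin (-1) (usub1 S) (usub1 S).
by under eq_fun do rewrite scaleN1r addNr.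
Qed.

Lemma bounded_member_submod : submod_closed bounded_member.
Proof.
split.
  apply/bounded_memberP; split; first exact: usub0.
  by exists 0 => x; rewrite nrm0.
move=> c f g /bounded_memberP[Sf [M fM]] /bounded_memberP[Sg [N gN]].
apply/bounded_memberP; split; first exact: usub_lin.
exists (complex.Re `|c| * M + N) => x.
apply: le_trans (nrmD _ _) _; rewrite lerD// nrmZ ler_wpM2l//.
by rewrite normc_def /= sqrtr_ge0.
Qed.

HB.instance Definition _ := GRing.isSubmodClosed.Build C (X -> A)
  bounded_member bounded_member_submod.

(** The algebra of the bounded functions in [S], with the supremum norm. The type
    [X] is pointed so that the supremum is over a nonempty set. *)
Record bfun := BFun {
  bfun_val :> X -> A;
  bfun_prop : bfun_val \in bounded_member }.

HB.instance Definition _ := [isSub for bfun_val].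
HB.instance Definition _ := [Choice of bfun by <:].
HB.instance Definition _ := [SubChoice_isSubLmodule of bfun by <:].

Implicit Types (f g h : bfun).

Lemma bfunP f g : (forall x, f x = g x) -> f = g.
Proof. by move=> fg; apply: val_inj; apply/funext => x /=; exact: fg. Qed.

Definition supnorm f : R := sup (range (fun x => nrm (f x))).

Lemma bfun_has_sup f : has_sup (range (fun x => nrm (f x))).
Proof.
have /bounded_memberP[_ [M fM]] := bfun_prop f.
split; first by exists (nrm (f point)), point.
by exists M => _ [x _ <-].
Qed.

Lemma le_supnorm f x : nrm (f x) <= supnorm f.
Proof. by apply: ub_le_sup; [have [] := bfun_has_sup f|exists x]. Qed.

Lemma supnorm_le f (M : R) : (forall x, nrm (f x) <= M) -> supnorm f <= M.
Proof.
move=> fM; apply: ge_sup; first by have [] := bfun_has_sup f.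
by move=> _ [x _ <-].
Qed.

Lemma supnorm_ge0 f : 0 <= supnorm f.
Proof. exact: le_trans (nrm_ge0 _) (le_supnorm f point). Qed.

Lemma bfun_addE f g x : (f + g) x = f x + g x. Proof. by []. Qed.
Lemma bfun_scaleE (c : C) f x : (c *: f) x = c *: f x. Proof. by []. Qed.

Definition bfun_norm f : C := (supnorm f)%:C%C.

Lemma bfun_normD f g : bfun_norm (f + g) <= bfun_norm f + bfun_norm g.
Proof.
rewrite /bfun_norm -rmorphD /= lecR; apply: supnorm_le => x.
by apply: le_trans (nrmD _ _) _; rewrite lerD// le_supnorm.
Qed.

Lemma bfun_normZ (c : C) f : bfun_norm (c *: f) = `|c| * bfun_norm f.
Proof.
have -> : `|c| = (complex.Re `|c|)%:C%C by rewrite normc_def.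
rewrite /bfun_norm -rmorphM; congr (_%:C)%C.
have c0 : 0 <= complex.Re `|c| by rewrite normc_def /= sqrtr_ge0.
apply/le_anti/andP; split.
  by apply: supnorm_le => x; rewrite bfun_scaleE nrmZ ler_wpM2l// le_supnorm.
have [->|cN0] := eqVneq (complex.Re `|c|) 0; first by rewrite mul0r supnorm_ge0.
have cpos : 0 < complex.Re `|c| by rewrite lt_neqAle eq_sym cN0.
rewrite mulrC -ler_pdivlMr//; apply: supnorm_le => x.
rewrite ler_pdivlMr// mulrC; apply: le_trans (le_supnorm (c *: f) x).
by rewrite bfun_scaleE nrmZ.
Qed.

Lemma bfun_norm0 f : bfun_norm f = 0 -> f = 0.
Proof.
move=> [f0]; apply: bfunP => x; apply: nrm_eq0; apply/le_anti.
by rewrite nrm_ge0 andbT -f0 le_supnorm.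
Qed.

HB.instance Definition _ := @Lmodule_isNormed.Build C bfun bfun_norm
  bfun_normD bfun_normZ bfun_norm0.

Lemma bfun_normE f : `|f| = (supnorm f)%:C%C. Proof. by []. Qed.

Lemma posC (eps : C) : 0 < eps -> exists2 e : R, 0 < e & eps = e%:C%C.
Proof.
rewrite ltcE /= => /andP[/eqP i0 r0]; exists (complex.Re eps) => //.
by case: eps i0 r0 => a b /= ->.
Qed.

Lemma bfun_ballE f g (e : R) :
  ball f e%:C%C g -> forall x, nrm (f x - g x) < e.
Proof.
rewrite -ball_normE /= bfun_normE ltcR => fg x; apply: le_lt_trans fg.
exact: (le_supnorm (f - g)).
Qed.

Lemma bfun_cauchy_cvg (F : set_system bfun) : ProperFilter F -> cauchy F -> cvg F.
Proof.
move=> FF /cauchyP Fc.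
have {}Fc (e : R) : 0 < e -> exists f : bfun,
    \forall h \near F, forall x, nrm (f x - bfun_val h x) < e.
  move=> e0; have [|f Ff] := Fc e%:C%C; first by rewrite ltcR.
  by exists f; apply: filterS Ff => h; exact: bfun_ballE.
(* The limit is the pointwise limit [g]; a Cauchy filter converges to it
   uniformly, hence [g] is bounded and belongs to [S]. *)
have cvgx x : cvg ((fun f : bfun => f x) @ F).
  apply/cauchy_cvgP/cauchy_exP => eps /posC[e e0 ->].
  have [f Ff] := Fc e e0; exists (f x); apply: filterS Ff => h fh.
  by rewrite /= -ball_normE /= nrmE ltcR.
pose g x : A := lim ((fun f : bfun => f x) @ F).
have gP (e : R) : 0 < e -> \forall h \near F, forall x, nrm (bfun_val h x - g x) <= 4 * e.
  move=> e0; have [f Ff] := Fc e e0.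
  have fg x : nrm (f x - g x) <= 2 * e.
    have /cvgrPdist_lt/(_ e%:C%C) : (fun f : bfun => f x) @ F --> g x by exact: cvgx.
    rewrite ltcR => /(_ e0) hg.
    have [h [fh gh]] := filter_ex (filterI Ff hg).
    rewrite (_ : f x - g x = (f x - h x) - (g x - h x)); last first.
      by rewrite opprB addrA subrK.
    apply: le_trans (nrmB _ _) _; move: gh; rewrite nrmE ltcR => gh.
    have := fh x; lra.
  apply: filterS Ff => h fh x.
  rewrite (_ : h x - g x = (f x - g x) - (f x - h x)); last first.
    by rewrite opprB [RHS]addrC subrKA.
  apply: le_trans (nrmB _ _) _; have := fg x; have := fh x; lra.
have gmem : g \in bounded_member.
  apply/bounded_memberP; split.
    apply: usub_closed => e e0.
    have [|h hg] := filter_ex (gP (e / 4) _); first by rewrite divr_gt0.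
    have /bounded_memberP[Sh _] := bfun_prop h; exists h => // x.
    by apply: le_trans (hg x) _; rewrite mulrC divfK.
  have [h hg] := filter_ex (gP 1 ltr01).
  exists (supnorm h + 4) => x.
  rewrite (_ : g x = h x - (h x - g x)); last by rewrite opprB [RHS]addrC subrK.
  apply: le_trans (nrmB _ _) _; apply: lerD; first exact: le_supnorm.
  by apply: le_trans (hg x) _; rewrite mulr1.
apply/cvg_ex; exists (BFun gmem); apply/cvgrPdist_le => eps /posC[e e0 ->].
have := gP (e / 4); rewrite divr_gt0// => /(_ isT); apply: filterS => h hg.
rewrite bfun_normE lecR; apply: supnorm_le => x; rewrite nrm_distC.
by apply: le_trans (hg x) _; rewrite mulrC divfK.
Qed.

HB.instance Definition _ := Uniform_isComplete.Build bfun bfun_cauchy_cvg.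

Lemma bfun_one_subproof : (fun=> cone) \in bounded_member.
Proof.
by apply/bounded_memberP; split; [exact: usub1|exists (nrm (cone : A))].
Qed.

Definition bfun_one : bfun := BFun bfun_one_subproof.

Lemma bfun_mul_subproof f g : (fun x => f x ** g x) \in bounded_member.
Proof.
have /bounded_memberP[Sf _] := bfun_prop f.
have /bounded_memberP[Sg _] := bfun_prop g.
apply/bounded_memberP; split; first exact: usubM.
exists (supnorm f * supnorm g) => x; apply: le_trans (nrmM _ _) _.
by apply: ler_pM; rewrite ?nrm_ge0 ?le_supnorm.
Qed.

Definition bfun_mul f g : bfun := BFun (bfun_mul_subproof f g).

Lemma bfun_star_subproof f : (fun x => star (f x)) \in bounded_member.
Proof.
have /bounded_memberP[Sf _] := bfun_prop f.
apply/bounded_memberP; split; first exact: usub_star.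
by exists (supnorm f) => x; rewrite nrm_star le_supnorm.
Qed.

Definition bfun_star f : bfun := BFun (bfun_star_subproof f).

Fact bfun_mulA : associative bfun_mul.
Proof. by move=> f g h; apply: bfunP => x; exact: cmulA. Qed.
Fact bfun_mul1x : left_id bfun_one bfun_mul.
Proof. by move=> f; apply: bfunP => x; exact: cmul1x. Qed.
Fact bfun_mulx1 : right_id bfun_one bfun_mul.
Proof. by move=> f; apply: bfunP => x; exact: cmulx1. Qed.
Fact bfun_mulDl : left_distributive bfun_mul +%R.
Proof. by move=> f g h; apply: bfunP => x; exact: cmulDl. Qed.
Fact bfun_mulDr : right_distributive bfun_mul +%R.
Proof. by move=> f g h; apply: bfunP => x; exact: cmulDr. Qed.
Fact bfun_mulZl (c : C) f g : bfun_mul (c *: f) g = c *: bfun_mul f g.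
Proof. by apply: bfunP => x; exact: cmulZl. Qed.
Fact bfun_mulZr (c : C) f g : bfun_mul f (c *: g) = c *: bfun_mul f g.
Proof. by apply: bfunP => x; exact: cmulZr. Qed.
Fact bfun_starD f g : bfun_star (f + g) = bfun_star f + bfun_star g.
Proof. by apply: bfunP => x; exact: starD. Qed.
Fact bfun_starZ (c : C) f : bfun_star (c *: f) = c^* *: bfun_star f.
Proof. by apply: bfunP => x; exact: starZ. Qed.
Fact bfun_starM f g : bfun_star (bfun_mul f g) = bfun_mul (bfun_star g) (bfun_star f).
Proof. by apply: bfunP => x; exact: starM. Qed.
Fact bfun_starK : involutive bfun_star.
Proof. by move=> f; apply: bfunP => x; exact: starK. Qed.
Fact bfun_mul_norm f g : `|bfun_mul f g| <= `|f| * `|g|.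
Proof.
rewrite !bfun_normE -rmorphM lecR; apply: supnorm_le => x.
apply: le_trans (nrmM _ _) _.
by apply: ler_pM; rewrite ?nrm_ge0 ?le_supnorm.
Qed.
Fact bfun_star_norm f : `|bfun_mul (bfun_star f) f| = `|f| ^+ 2.
Proof.
rewrite !bfun_normE -rmorphXn; congr (_%:C)%C; apply/le_anti/andP; split.
  apply: supnorm_le => x; rewrite nrm_star_mul ler_sqr ?nnegrE ?nrm_ge0 ?supnorm_ge0//.
  exact: le_supnorm.
set s := supnorm (bfun_mul _ _); have s0 : 0 <= s by exact: supnorm_ge0.
rewrite -(sqr_sqrtr s0) ler_sqr ?nnegrE ?supnorm_ge0 ?sqrtr_ge0//.
apply: supnorm_le => x.
rewrite -ler_sqr ?nnegrE ?nrm_ge0 ?sqrtr_ge0// sqr_sqrtr// -nrm_star_mul.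
exact: (le_supnorm (bfun_mul (bfun_star f) f)).
Qed.

HB.instance Definition _ := isCStar.Build R bfun bfun_mulA bfun_mul1x bfun_mulx1
  bfun_mulDl bfun_mulDr bfun_mulZl bfun_mulZr bfun_starD bfun_starZ bfun_starM
  bfun_starK bfun_mul_norm bfun_star_norm.

Lemma bfun_eval_morphism x : star_morphism (fun f : bfun => f x).
Proof. by []. Qed.

End BoundedFunctions.

(** * Consequences of the universal property *)

Section Universality.
Variables (R : realType) (n : nat) (A : cstarType R).
Variables (e : 'rV[QmodZ]_n -> A) (mu : posmx n -> A).
Hypothesis A_BC : is_BC_algebra e mu.
Local Notation C := R[i].

(** The sum on the left is over the [s] in [P] for which [F s] is not zero, and it
    is zero if these are infinitely many: the hypothesis makes the two index
    sets equal. *)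
Lemma eval_fsbig (X : pointedType) (S : uniform_subalgebra X A) (T : choiceType)
    (P : set T) (F : T -> bfun S) (x : X) :
  (forall s, F s x = 0 -> F s = 0) ->
  (\sum_(s \in P) F s) x = \sum_(s \in P) F s x.
Proof.
move=> F0.
have -> : finite_support 0 P F = finite_support 0 P (fun s => F s x).
  rewrite /finite_support.
  have -> // : P `&` F @^-1` [set~ 0] = P `&` (fun s => F s x) @^-1` [set~ 0].
  by apply/seteqP; split=> s [Ps Fs]; split=> // Fs0; apply: Fs; rewrite ?Fs0//; exact: F0.
elim: (finite_support _ _ _) => [|s r IH]; first by rewrite !big_nil.
by rewrite !big_cons bfun_addE IH.
Qed.

Lemma norm_unit_scalar (c : C) : c^* * c = 1 -> `|c| = 1.
Proof.
move=> c1; have : `|c| ^+ 2 = 1 by rewrite normCK mulrC.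
by move/eqP; rewrite sqrp_eq1// => /eqP.
Qed.

(** A twist of the isometries by a multiplicative family of scalars of modulus
    one, which depends on a parameter in [X], satisfies the relations in the
    algebra of bounded functions on [X]. *)
Lemma BC_twisted_functions (X : pointedType) (S : uniform_subalgebra X A)
    (c : X -> posmx n -> C) :
  (forall x a, (c x a)^* * c x a = 1) ->
  (forall x a b, c x (posmx_mul a b) = c x a * c x b) ->
  (forall r, S (fun=> e r)) -> (forall a, S (fun x => c x a *: mu a)) ->
  exists f : A -> bfun S, [/\ star_morphism f, forall r x, f (e r) x = e r
    & forall a x, f (mu a) x = c x a *: mu a].
Proof.
move=> c1 cM Se Smu; have [BC univ] := A_BC.
have eS r : (fun=> e r) \in bounded_member S.
  by apply/bounded_memberP; split=> //; exists (nrm (e r)).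
have muS a : (fun x => c x a *: mu a) \in bounded_member S.
  apply/bounded_memberP; split=> //; exists (nrm (mu a)) => x.
  by rewrite nrmZ norm_unit_scalar// mul1r.
pose e' r := BFun (eS r); pose mu' a := BFun (muS a).
have conjK x a : c x a * (c x a)^* = 1 by rewrite mulrC.
have BC' : BC_relations e' mu'.
  split.
  - by apply: bfunP => x /=; exact: (BC_e0 BC).
  - by move=> r s; apply: bfunP => x /=; exact: (BC_eD BC).
  - by move=> r; apply: bfunP => x /=; exact: (BC_star_e BC).
  - move=> a; apply: bfunP => x /=.
    by rewrite starZ cmulZl cmulZr scalerA c1 scale1r (BC_isometry BC).
  - move=> a b; apply: bfunP => x /=.
    by rewrite cmulZl cmulZr scalerA (BC_muM BC) cM.
  - move=> a b; apply: bfunP => x /=.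
    by rewrite starZ cmulZl cmulZr scalerA cM mulrA c1 mul1r (BC_star_mu BC).
  - move=> a r; apply: bfunP => x; rewrite bfun_scaleE eval_fsbig.
      rewrite -[RHS](BC_covariance BC) /=.
      by rewrite starZ !cmulZl cmulZr scalerA conjK scale1r.
    by move=> s /= es0; apply: bfunP.
have [f [[fm fe fmu] _]] := univ _ _ _ BC'.
by exists f; split=> // [r x|a x]; [have := fe r|have := fmu a] => /= ->.
Qed.

Lemma star_morphism_comp (A1 A2 A3 : cstarType R) (f : A1 -> A2) (g : A2 -> A3) :
  star_morphism f -> star_morphism g -> star_morphism (g \o f).
Proof.
move=> [fl f1 fM fs] [gl g1 gM gs]; split=> [c x y||x y|x] /=.
- by rewrite fl gl.
- by rewrite f1 g1.
- by rewrite fM gM.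
- by rewrite fs gs.
Qed.

(** A twist of the isometries extends to at most one morphism. *)
Lemma BC_morphism_unique (c : posmx n -> C) (f g : A -> A) :
  (forall a, (c a)^* * c a = 1) ->
  (forall a b, c (posmx_mul a b) = c a * c b) ->
  star_morphism f -> (forall r, f (e r) = e r) ->
  (forall a, f (mu a) = c a *: mu a) ->
  star_morphism g -> (forall r, g (e r) = e r) ->
  (forall a, g (mu a) = c a *: mu a) -> f = g.
Proof.
move=> c1 cM fm fe fmu gm ge gmu; have [BC univ] := A_BC.
have BC' : BC_relations e (fun a => c a *: mu a).
  split; [exact: (BC_e0 BC)|exact: (BC_eD BC)|exact: (BC_star_e BC)|..].
  - by move=> a; rewrite starZ cmulZl cmulZr scalerA c1 scale1r (BC_isometry BC).
  - by move=> a b; rewrite cmulZl cmulZr scalerA (BC_muM BC) cM.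
  - move=> a b.
    by rewrite starZ cmulZl cmulZr scalerA cM mulrA c1 mul1r (BC_star_mu BC).
  - move=> a r; rewrite -(BC_covariance BC).
    by rewrite starZ !cmulZl cmulZr scalerA [c a * _]mulrC c1 scale1r.
have [h [_ hu]] := univ _ _ _ BC'.
by rewrite -(hu f) ?(hu g).
Qed.

(** The generators are contained in no proper closed *-subalgebra [D]. The algebra
    [D] is realized as an algebra of functions on a point. *)
Lemma BC_generated (D : set A) :
  D cone -> (forall (c : C) a b, D a -> D b -> D (c *: a + b)) ->
  (forall a b, D a -> D b -> D (a ** b)) -> (forall a, D a -> D (star a)) ->
  (forall a, (forall eps : R, 0 < eps -> exists2 b, D b & nrm (b - a) <= eps) ->
     D a) ->
  (forall r, D (e r)) -> (forall a, D (mu a)) -> forall a, D a.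
Proof.
move=> D1 Dlin DM Dstar Dcl De Dmu.
pose S : uniform_subalgebra unit A := @Build_uniform_subalgebra R unit A
  (fun f => D (f tt)) D1 (fun c f g => Dlin c _ _) (fun f g => DM _ _)
  (fun f => Dstar _)
  (fun g gD => Dcl (g tt) (fun eps eps0 =>
     let: ex_intro2 f Sf fg := gD eps eps0 in ex_intro2 _ _ (f tt) Sf (fg tt))).
have one1 (a : posmx n) : (1 : C)^* * 1 = 1 by rewrite conjC1 mulr1.
have [|||a|f [fm fe fmu]] := @BC_twisted_functions unit S (fun _ _ => 1).
- by move=> _; exact: one1.
- by move=> *; rewrite mulr1.
- by move=> r; exact: De.
- by rewrite /= scale1r; exact: Dmu.
move=> a.
(* The composition [A -> D -> A] fixes the generators. *)
have fa : (fun b => f b tt) = id.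
  apply: (@BC_morphism_unique (fun=> 1)) => //.
  - by move=> *; rewrite mulr1.
  - exact: (star_morphism_comp fm (bfun_eval_morphism S tt)).
  - by move=> b; rewrite scale1r.
rewrite -[a]/(id a) -fa.
by have /bounded_memberP[] := bfun_prop (f a).
Qed.

Lemma logdetM (a b : posmx n) : logdet R (posmx_mul a b) = logdet R a + logdet R b.
Proof.
rewrite /logdet /= det_mulmx rmorphM /= lnM// posrE ltr0z; exact: posmx_det.
Qed.

Lemma logdet_ge0 (a : posmx n) : 0 <= logdet R a.
Proof. by apply: ln_ge0; rewrite ler1z -gtz0_ge1 posmx_det. Qed.

Lemma expi_logdet_unit (t : R) (a : posmx n) :
  (expi (t * logdet R a))^* * expi (t * logdet R a) = 1.
Proof. exact: expi_conjM. Qed.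

Lemma expi_logdetM (t : R) (a b : posmx n) : expi (t * logdet R (posmx_mul a b)) =
  expi (t * logdet R a) * expi (t * logdet R b).
Proof. by rewrite logdetM mulrDr expiD. Qed.

End Universality.

(** * The time evolution *)

Section ContinuousFunctions.
Variables (R : realType) (A : cstarType R).
Local Notation C := R[i].
Implicit Types f g : R -> A.

Lemma nrm_continuousP f : continuous f <->
  forall t (eps : R), 0 < eps -> \forall s \near t, nrm (f t - f s) < eps.
Proof.
split=> [fc t eps eps0|fc t].
  have /cvgrPdist_lt/(_ eps%:C%C) := fc t; rewrite ltcR => /(_ eps0).
  by apply: filterS => s; rewrite nrmE ltcR.
apply/cvgrPdist_lt => _ /posC[eps eps0 ->]; apply: filterS (fc t _ eps0) => s.
by rewrite nrmE ltcR.
Qed.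

Lemma continuous_lin (c : C) f g : continuous f -> continuous g ->
  continuous (fun x => c *: f x + g x).
Proof.
move=> fc gc t; apply: cvgD; last exact: gc.
by apply: cvgZl_tmp; exact: fc.
Qed.

Lemma continuous_cmul f g : continuous f -> continuous g ->
  continuous (fun x => f x ** g x).
Proof.
move=> /nrm_continuousP fc /nrm_continuousP gc; apply/nrm_continuousP => t eps eps0.
pose M := nrm (f t) + nrm (g t) + 1.
have M0 : 0 < M by rewrite ltr_wpDl// addr_ge0 ?nrm_ge0.
have d0 : 0 < eps / (2 * M) by rewrite divr_gt0// mulr_gt0.
near=> s.
have fs : nrm (f t - f s) < eps / (2 * M) by near: s; exact: fc.
have gs : nrm (g t - g s) < eps / (2 * M) by near: s; exact: gc.
have fs1 : nrm (f t - f s) < 1 by near: s; exact: fc.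
have -> : f t ** g t - f s ** g s = (f t - f s) ** g t + f s ** (g t - g s).
  by rewrite cmulDl cmulDr cmulNl cmulNr addrA subrK.
apply: le_lt_trans (nrmD _ _) _.
have h1 : nrm ((f t - f s) ** g t) <= eps / (2 * M) * nrm (g t).
  by apply: le_trans (nrmM _ _) _; rewrite ler_wpM2r ?nrm_ge0// ltW.
have fsM : nrm (f s) <= nrm (f t) + 1.
  rewrite (_ : f s = f t - (f t - f s)); last by rewrite opprB [RHS]addrC subrK.
  by apply: le_trans (nrmB _ _) _; rewrite lerD2l ltW.
have h2 : nrm (f s ** (g t - g s)) <= (nrm (f t) + 1) * (eps / (2 * M)).
  by apply: le_trans (nrmM _ _) _; apply: ler_pM; rewrite ?nrm_ge0// ltW.
have h3 : eps / (2 * M) * M = eps / 2.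
  by rewrite invfM mulrA -mulrA mulVf ?mulr1// gt_eqF.
have : eps / (2 * M) * nrm (g t) + (nrm (f t) + 1) * (eps / (2 * M)) = eps / 2.
  by rewrite -h3 /M; ring.
lra.
Unshelve. all: by end_near. Qed.

Lemma continuous_star f : continuous f -> continuous (fun x => star (f x)).
Proof.
move=> /nrm_continuousP fc; apply/nrm_continuousP => t eps eps0.
apply: filterS (fc t eps eps0) => s.
by rewrite -nrm_star starD starN.
Qed.

Lemma continuous_expi_scale (u : R) (a : A) :
  continuous (fun t : R => expi (t * u) *: a).
Proof.
apply/nrm_continuousP => t eps eps0.
have M0 : 0 < `|u| * nrm a + 1 by rewrite ltr_wpDl// mulr_ge0 ?nrm_ge0.
near=> s; rewrite -scalerBl nrmZ.
have h : complex.Re `|expi (t * u) - expi (s * u)| <= `|t - s| * `|u|.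
  rewrite normc_def /= -normrM -sqrtr_sqr; apply: ler_wsqrtr.
  have -> : t * u = s * u + (t - s) * u by ring.
  have := sqnormc_expiB1 ((t - s) * u); rewrite -(sqnormc_expiM (s * u) (_ - 1)).
  by rewrite mulrBr mulr1 -expiD.
apply: le_lt_trans (ler_wpM2r (nrm_ge0 a) h) _.
have st : `|t - s| < eps / (`|u| * nrm a + 1).
  by near: s; apply: (@cvgr_dist_lt _ R^o _ _ _ id t) => //; rewrite divr_gt0.
rewrite ltr_pdivlMr// in st; apply: le_lt_trans st.
by rewrite -mulrA ler_wpM2l// lerDl.
Unshelve. all: by end_near. Qed.

Lemma uniform_limit_continuous g : (forall eps : R, 0 < eps ->
    exists2 f, continuous f & forall x, nrm (f x - g x) <= eps) -> continuous g.
Proof.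
move=> gf; apply/nrm_continuousP => t eps eps0.
have [|f fc fg] := gf (eps / 4); first by rewrite divr_gt0.
have e4 : 0 < eps / 4 by rewrite divr_gt0.
apply: filterS ((nrm_continuousP f).1 fc t _ e4) => s fts.
have -> : g t - g s = (f s - g s) - ((f s - f t) + (f t - g t)).
  by rewrite subrKA opprB [RHS]addrC subrKA.
apply: le_lt_trans (nrmB _ _) _.
have := nrmD (f s - f t) (f t - g t); have := fg t; have := fg s.
rewrite nrm_distC in fts; lra.
Qed.

(** The uniform subalgebra of the continuous functions of a real variable. *)
Definition continuous_subalgebra : uniform_subalgebra R A :=
  @Build_uniform_subalgebra R R A (fun f => continuous f)
    (fun=> cvg_cst _) continuous_lin continuous_cmul continuous_star
    uniform_limit_continuous.

End ContinuousFunctions.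

Section TimeEvolution.
Variables (R : realType) (n : nat) (A : cstarType R).
Variables (e : 'rV[QmodZ]_n -> A) (mu : posmx n -> A).
Hypothesis A_BC : is_BC_algebra e mu.

(** The time evolution is the evaluation of a morphism to the algebra of bounded
    continuous functions, hence it is continuous in the time variable. *)
Lemma BC_evolution_exists : exists sigma : R -> A -> A, BC_evolution e mu sigma.
Proof.
have [||r|a|f [fm fe fmu]] := @BC_twisted_functions R n A e mu A_BC R
  (continuous_subalgebra A) (fun t a => expi (t * logdet R a)).
- exact: expi_logdet_unit.
- exact: expi_logdetM.
- by move=> x; exact: cvg_cst.
- exact: continuous_expi_scale.
pose sigma t a := f a t.
have sm t : star_morphism (sigma t).
  exact: (star_morphism_comp fm (bfun_eval_morphism (continuous_subalgebra A) t)).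
have s0 : sigma 0 =1 id.
  move=> a; suff -> : sigma 0 = id by [].
  apply: (BC_morphism_unique A_BC (c := fun=> 1)) => //.
  - by move=> *; rewrite conjC1 mulr1.
  - by move=> *; rewrite mulr1.
  - by move=> r; exact: fe.
  - by move=> b; rewrite /sigma fmu mul0r expi0.
  - by move=> b; rewrite scale1r.
have sD s t : sigma (s + t) =1 sigma s \o sigma t.
  move=> a; suff -> : sigma (s + t) = sigma s \o sigma t by [].
  apply: (BC_morphism_unique A_BC (c := fun b => expi ((s + t) * logdet R b))) => //.
  - by move=> b; exact: expi_logdet_unit.
  - by move=> b b'; exact: expi_logdetM.
  - by move=> r; exact: fe.
  - by move=> b; exact: fmu.
  - exact: star_morphism_comp.
  - by move=> r /=; rewrite /sigma !fe.
  - move=> b /=; rewrite [sigma t _]fmu.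
    by rewrite (star_morphismZ _ _ (sm s)) [sigma s _]fmu scalerA -expiD mulrDl addrC.
exists sigma; split.
- split=> // [t|a].
    split=> //; exists (sigma (- t)) => a.
      by have := sD (- t) t a; rewrite addNr s0.
    by have := sD t (- t) a; rewrite addrN s0.
  by have /bounded_memberP[] := bfun_prop (f a).
- by move=> t a; exact: fmu.
- by move=> t r; exact: fe.
Qed.

Lemma BC_evolution_unique (s1 s2 : R -> A -> A) :
  BC_evolution e mu s1 -> BC_evolution e mu s2 -> s1 = s2.
Proof.
move=> [[m1 _ _ _] mu1 e1] [[m2 _ _ _] mu2 e2]; apply/funext => t.
apply: (BC_morphism_unique A_BC (c := fun b => expi (t * logdet R b))) => //.
- by move=> b; exact: expi_logdet_unit.
- by move=> b b'; exact: expi_logdetM.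
- by have [] := m1 t.
- by have [] := m2 t.
Qed.

End TimeEvolution.

(** * Representations on square-summable families *)

Section GeometricSeries.
Variables (R : realType) (A : cstarType R) (q : A).
Hypothesis q1 : nrm q < 1.

Let y (k : nat) : A := iter k (fun b => cone + b ** q) 0.

(* [y (k + m) - y k] is [y m ** q ^ k]. *)
Let yB k m : nrm (y (k + m) - y k) <= nrm q ^+ k * nrm (y m).
Proof.
elim: k => [|k IH]; first by rewrite expr0 mul1r subr0.
rewrite addSn /y !iterS -/(y _) -/(y _) opprD addrACA subrr add0r -cmulNl -cmulDl.
apply: le_trans (nrmM _ _) _.
by rewrite mulrC exprS -mulrA ler_wpM2l ?nrm_ge0.
Qed.

Let bound : R := nrm (cone : A) / (1 - nrm q).

Let y_bound m : nrm (y m) <= bound.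
Proof.
have q0 : 0 < 1 - nrm q by rewrite subr_gt0.
have bE : nrm (cone : A) + bound * nrm q = bound by rewrite /bound; field; rewrite gt_eqF.
elim: m => [|m IH]; first by rewrite nrm0 divr_ge0 ?nrm_ge0// ltW.
rewrite /y iterS -/(y _) -bE; apply: le_trans (nrmD _ _) _.
rewrite lerD2l; apply: le_trans (nrmM _ _) _.
by rewrite ler_wpM2r ?nrm_ge0.
Qed.

Let tail (eps : R) : 0 < eps ->
  exists k, forall m, (k <= m)%N -> nrm (y m - y k) <= eps.
Proof.
move=> eps0; have b0 : 0 <= bound by exact: le_trans (nrm_ge0 _) (y_bound 0).
have qn : (fun k => nrm q ^+ k) @ \oo --> (0 : R).
  by apply: cvg_expr; rewrite ger0_norm ?nrm_ge0.
have d0 : 0 < eps / (bound + 1) by rewrite divr_gt0// ltr_wpDl.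
move/cvgrPdist_lt : qn => /(_ _ d0) [k _ /(_ k (leqnn k)) /=].
rewrite sub0r normrN ger0_norm ?exprn_ge0 ?nrm_ge0// ltr_pdivlMr ?ltr_wpDl// => kE.
exists k => m km; rewrite -(subnKC km); apply: le_trans (yB _ _) _.
have qk0 : 0 <= nrm q ^+ k by rewrite exprn_ge0 ?nrm_ge0.
apply: le_trans (ler_wpM2l qk0 (y_bound _)) _; lra.
Qed.

(** The inverse of [cone - q], as the limit of the partial sums of the
    geometric series. *)
Lemma geometric_inverse : exists b : A, b ** (cone - q) = cone.
Proof.
have cy : cvgn y.
  apply/cauchy_cvgP/cauchy_exP => _ /posC[eps eps0 ->].
  have [|k kE] := tail (eps := eps / 2); first by rewrite divr_gt0.
  exists (y k), k => // m /= km; rewrite -ball_normE /= nrmE ltcR nrm_distC.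
  by apply: le_lt_trans (kE m km) _; lra.
pose b := limn y; exists b.
suff bE : b = cone + b ** q.
  by rewrite cmulDr cmulx1 cmulNr; apply/eqP; rewrite subr_eq -bE.
apply/eqP; rewrite -subr_eq0; apply/eqP; apply: nrm_eq0; apply/le_anti.
rewrite nrm_ge0 andbT; apply/ler_addgt0Pl => eps eps0; rewrite addr0.
have /cvgrPdist_lt/(_ (eps / 2)%:C%C) : y @ \oo --> b by exact: cy.
rewrite ltcR divr_gt0// => /(_ isT) [k _ kE].
have h0 : nrm (b - y k) < eps / 2 by rewrite -ltcR -nrmE; exact: (kE k (leqnn k)).
have h1 : nrm (b - y k.+1) < eps / 2 by rewrite -ltcR -nrmE; exact: (kE k.+1 (leqnSn k)).
have -> : b - (cone + b ** q) = (b - y k.+1) - (b - y k) ** q.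
  by rewrite /y iterS -/(y k) cmulDl cmulNl opprB !opprD !addrA subrK.
apply: le_trans (nrmB _ _) _.
have h2 : nrm ((b - y k) ** q) <= nrm (b - y k).
  apply: le_trans (nrmM _ _) _; rewrite ler_piMr ?nrm_ge0//; exact: ltW.
lra.
Qed.

End GeometricSeries.

Section Representations.
Variables (R : realType) (n : nat) (A : cstarType R).
Local Notation Hn := (ell2 R (posmx n)).
Local Notation C := R[i].
Variable pi : A -> {linear Hn -> Hn}.
Hypothesis piR : star_representation pi.
Implicit Types (a b h : A) (x y : Hn).

Lemma repD a b x : pi (a + b) x = pi a x + pi b x.
Proof. by have [_ lin _ _ _] := piR; rewrite -[a]scale1r lin !scale1r. Qed.

Lemma rep0 x : pi 0 x = 0.
Proof.
by have [_ lin _ _ _] := piR; have := lin (-1) 0 0 x; rewrite scaleN1r addNr scaleN1r addNr.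
Qed.

Lemma repZ (c : C) a x : pi (c *: a) x = c *: pi a x.
Proof. by have [_ lin _ _ _] := piR; have := lin c a 0 x; rewrite !rep0 !addr0. Qed.

Lemma repB a b x : pi (a - b) x = pi a x - pi b x.
Proof. by rewrite repD -[- b]scaleN1r repZ scaleN1r. Qed.

Lemma rep_adjoint a x y : inner (pi a x) y = inner x (pi (star a) y).
Proof. by have [_ _ _ _ adj] := piR; rewrite -adj starK. Qed.

Lemma rep_star_coord a x (i : posmx n) : pi (star a) x i = inner (pi a (delta i)) x.
Proof. by rewrite rep_adjoint inner_delta. Qed.

(** If [m] is larger than [nrm h ^+ 2] then [m - pi h ^ 2] is bounded below, so
    that [m] is not the best constant. *)
Lemma rep_bound_improve h (m : R) : star h = h -> nrm h ^+ 2 < m ->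
  (forall x, sq (pi h x) <= m * sq x) ->
  exists2 m', m' < m & forall x, sq (pi h x) <= m' * sq x.
Proof.
move=> hh hm hb; have [bd _ pi1 piM _] := piR.
have m0 : 0 < m by apply: le_lt_trans hm; rewrite sqr_ge0.
pose r := m^-1; have r0 : 0 < r by rewrite invr_gt0.
have rm : r * m = 1 by rewrite mulVf// gt_eqF.
pose q := r%:C%C *: (h ** h).
have q1 : nrm q < 1.
  rewrite nrmZ normc_def /= expr0n addr0 sqrtr_sqr gtr0_norm// -{1}hh nrm_star_mul.
  by rewrite mulrC ltr_pdivrMr// mul1r.
have [b bE] := geometric_inverse q1.
have [K K0 bK] := (bounded_operatorP (pi b)).1 (bd b).
have K1 : 0 < K + 1 by rewrite ltr_wpDl.
exists (m * (1 - (K + 1)^-1)).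
  by rewrite gtr_pMr// gtrBl invr_gt0.
move=> x; set T := sq (pi h x).
have xE : x = pi b (x - r%:C%C *: pi h (pi h x)).
  have := pi1 x; rewrite -bE piM /= repB pi1 repZ piM /= => {1}<-; done.
have RE : T = complex.Re (inner x (pi h (pi h x))).
  by have := rep_adjoint h x (pi h x); rewrite hh => <-; rewrite Re_inner_self.
(* With [s] the square norm of [x - r (pi h)^2 x], both [sq x <= K * s] and
   [s <= sq x - r * T] hold, which bounds [T] away from [m * sq x]. *)
have := bK (x - r%:C%C *: pi h (pi h x)); rewrite -xE => bx.
rewrite (Re_innerE _ _ r0) in RE.
set s := sq (x - _) in RE bx.
have s0 : 0 <= s by exact: sq_ge0.
set TT := sq (pi h (pi h x)) in RE.
have TTle : TT <= m * T by exact: hb.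
have sE : s = sq x + r ^+ 2 * TT - 2 * r * T.
  by rewrite RE; field; rewrite gt_eqF.
have rTT : r ^+ 2 * TT <= r * T.
  apply: le_trans (ler_wpM2l (sqr_ge0 r) TTle) _.
  by rewrite expr2 -mulrA (mulrA r m) rm mul1r.
have sle : s <= sq x - r * T by lra.
have xK : sq x <= (K + 1) * (sq x - r * T).
  by apply: (le_trans bx); apply: ler_pM => //; lra.
have : (K + 1)^-1 * sq x <= sq x - r * T by rewrite ler_pdivrMl.
move=> h1; have {h1} : r * T <= (1 - (K + 1)^-1) * sq x by lra.
by rewrite /r ler_pdivrMl// mulrA.
Qed.

Lemma rep_self_adjoint_contractive h x : star h = h ->
  sq (pi h x) <= nrm h ^+ 2 * sq x.
Proof.
move=> hh; have [bd _ _ _ _] := piR.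
pose B : set R := [set m | nrm h ^+ 2 <= m /\ forall x, sq (pi h x) <= m * sq x].
have [K K0 hK] := (bounded_operatorP (pi h)).1 (bd h).
have B0 : B !=set0.
  exists (Num.max (nrm h ^+ 2) K); split; first by rewrite le_max lexx.
  move=> z; apply: le_trans (hK z) _.
  by rewrite ler_wpM2r ?sq_ge0// le_max lexx orbT.
have hinf : has_inf B by split=> //; exists (nrm h ^+ 2) => m [].
have Binf : B (inf B).
  split; first by apply: lb_le_inf => // m [].
  move=> z; apply/ler_addgt0Pl => eps eps0.
  have d0 : 0 < eps / (sq z + 1) by rewrite divr_gt0// ltr_wpDl ?sq_ge0.
  have [m [_ mB] mle] := inf_adherent d0 hinf.
  apply: le_trans (mB z) _.
  apply: le_trans (ler_wpM2r (sq_ge0 z) (ltW mle)) _.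
  rewrite mulrDl addrC lerD2r mulrAC ler_pdivrMr ?ltr_wpDl ?sq_ge0//.
  by rewrite ler_wpM2l ?lerDl// ltW.
have [|lt] := leP (inf B) (nrm h ^+ 2).
  by move=> le; apply: le_trans (Binf.2 x) _; rewrite ler_wpM2r ?sq_ge0.
have [m' m'lt m'B] := rep_bound_improve hh lt Binf.2.
have : B (Num.max (nrm h ^+ 2) m').
  split; first by rewrite le_max lexx.
  move=> z; apply: le_trans (m'B z) _.
  by rewrite ler_wpM2r ?sq_ge0// le_max lexx orbT.
move=> /(ge_inf hinf.2); rewrite leNgt gt_max lt m'lt //.
Qed.

(** Representations are contractive. The bound [k] is positive so that [k^-1] can
    be the weight in [sq (pi a x) = Re (inner x (pi (star a ** a) x))]. *)
Lemma rep_contractive a (k : R) x : 0 < k -> nrm a ^+ 2 <= k ->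
  sq (pi a x) <= k * sq x.
Proof.
move=> k0 ak; have [_ _ _ piM _] := piR.
have hh : star (star a ** a) = star a ** a by rewrite starM starK.
have := rep_self_adjoint_contractive x hh; rewrite nrm_star_mul.
set z := pi _ x => zle.
have r0 : 0 < k^-1 by rewrite invr_gt0.
have -> : sq (pi a x) = complex.Re (inner x z).
  by rewrite -Re_inner_self rep_adjoint /z piM.
rewrite (Re_innerE _ _ r0).
have s0 := sq_ge0 (x - (k^-1)%:C%C *: z).
have a4 : (nrm a ^+ 2) ^+ 2 <= k ^+ 2 by rewrite ler_sqr ?nnegrE ?sqr_ge0// ltW.
have zk : sq z <= k ^+ 2 * sq x.
  by apply: le_trans zle _; rewrite ler_wpM2r ?sq_ge0.
have zk' : (k^-1) ^+ 2 * sq z <= sq x.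
  by rewrite exprVn ler_pdivrMl ?exprn_gt0.
rewrite ler_pdivrMr ?mulr_gt0//.
have -> : k * sq x * (2 / k) = 2 * sq x by field; rewrite gt_eqF.
lra.
Qed.

End Representations.

Section RepresentationsUnique.
Variables (R : realType) (n : nat) (A : cstarType R).
Local Notation Hn := (ell2 R (posmx n)).
Variables (e : 'rV[QmodZ]_n -> A) (mu : posmx n -> A).
Hypothesis A_BC : is_BC_algebra e mu.

(** A representation is determined by its values on the generators. *)
Lemma rep_unique (p1 p2 : A -> {linear Hn -> Hn}) :
  star_representation p1 -> star_representation p2 ->
  (forall r, p1 (e r) =1 p2 (e r)) -> (forall a, p1 (mu a) =1 p2 (mu a)) ->
  forall a, p1 a =1 p2 a.
Proof.
move=> r1 r2 pe pmu.
apply: (BC_generated A_BC (D := [set a | p1 a =1 p2 a])) => //=.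
- by have [_ _ o1 _ _] := r1; have [_ _ o2 _ _] := r2 => x; rewrite o1 o2.
- move=> c a b pa pb x; rewrite (repD r1) (repZ r1) (repD r2) (repZ r2).
  by rewrite pa pb.
- move=> a b pa pb x; have [_ _ _ m1 _] := r1; have [_ _ _ m2 _] := r2.
  by rewrite m1 m2 /= pb pa.
- move=> a pa x; apply: ell2P => i.
  by rewrite (rep_star_coord r1) (rep_star_coord r2) pa.
move=> a aD x; apply/eqP; rewrite -subr_eq0; apply/eqP; apply: sq_eq0.
apply/ler_addgt0Pl => eps eps0; rewrite addr0.
have d0 : 0 < eps / (4 * sq x + 1) by rewrite divr_gt0// ltr_wpDl ?mulr_ge0 ?sq_ge0.
set d := eps / _ in d0.
have [|b pb ba] := aD (Num.sqrt d); first by rewrite sqrtr_gt0.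
have ab : nrm (a - b) ^+ 2 <= d.
  rewrite -(sqr_sqrtr (ltW d0)) ler_sqr ?nnegrE ?nrm_ge0 ?sqrtr_ge0//.
  by rewrite nrm_distC.
have -> : p1 a x - p2 a x = p1 (a - b) x - p2 (a - b) x.
  by rewrite (repB r1) (repB r2) pb opprB addrA subrK.
apply: le_trans (sqB_le _ _) _.
have h1 := rep_contractive r1 x d0 ab; have h2 := rep_contractive r2 x d0 ab.
have : d * (4 * sq x + 1) = eps.
  by rewrite /d divfK// gt_eqF// ltr_wpDl ?mulr_ge0 ?sq_ge0.
lra.
Qed.

End RepresentationsUnique.

(** * The Hamiltonian and its spectrum *)

Section Hamiltonian.
Variables (R : realType) (n : nat) (A : cstarType R).
Variables (e : 'rV[QmodZ]_n -> A) (mu : posmx n -> A).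
Hypothesis A_BC : is_BC_algebra e mu.
Local Notation Hn := (ell2 R (posmx n)).
Local Notation C := R[i].
Local Notation U t := (phase (@logdet R n) t).

(** The conjugate of an operator by [exp(itH)]. *)
Definition conj_phase (t : R) (T : {linear Hn -> Hn}) : {linear Hn -> Hn} :=
  [the {linear Hn -> Hn} of U t \o T \o U (- t)].

Lemma conj_phaseE t (T : {linear Hn -> Hn}) x :
  conj_phase t T x = U t (T (U (- t) x)).
Proof. by []. Qed.

Lemma phaseNK t (x : Hn) : U (- t) (U t x) = x.
Proof. by rewrite -phaseD addNr phase0. Qed.

Lemma sq_conj_phase t (T : {linear Hn -> Hn}) (K : R) :
  (forall x, sq (T x) <= K * sq x) -> forall x, sq (conj_phase t T x) <= K * sq x.
Proof. by move=> TK x; rewrite conj_phaseE sq_phase; have := TK (U (- t) x); rewrite sq_phase. Qed.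

Lemma conj_phase_pi_mu a (T : {linear Hn -> Hn}) t x : is_pi_mu a T ->
  expi (t * logdet R a) *: T x = U t (T (U (- t) x)).
Proof.
move=> [/bounded_operatorP[K K0 TK] Td]; rewrite -conj_phaseE.
apply: (@bounded_eq_delta _ _ [the {linear Hn -> Hn} of expi (t * logdet R a) \*: T]
  (conj_phase t T) K) => [y||b].
- by rewrite /= sqZ sqnormc_expi mul1r.
- exact: sq_conj_phase.
rewrite conj_phaseE /= phase_delta linearZ /= Td linearZ /= phase_delta.
rewrite scalerA -expiD logdetM; congr (expi _ *: _); ring.
Qed.

Lemma conj_phase_pi_e rho r (T : {linear Hn -> Hn}) t x : is_pi_e rho r T ->
  T x = U t (T (U (- t) x)).
Proof.
move=> [/bounded_operatorP[K K0 TK] Td]; rewrite -conj_phaseE.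
apply: (@bounded_eq_delta _ _ T (conj_phase t T) K) => // [|b].
  exact: sq_conj_phase.
rewrite conj_phaseE phase_delta linearZ /= Td !linearZ /= phase_delta.
by rewrite scalerA mulrC scalerA -mulrA -expiD mulNr addNr expi0 mulr1.
Qed.

Lemma conj_phase_representation t (pi : A -> {linear Hn -> Hn}) :
  star_representation pi -> star_representation (fun a => conj_phase t (pi a)).
Proof.
move=> [bd lin p1 pM adj]; split=> [a|c a b x|x|a b x|a x y].
- have /bounded_operatorP[K K0 aK] := bd a.
  by apply/bounded_operatorP; exists K => //; exact: sq_conj_phase.
- by rewrite /= lin linearP.
- by rewrite /= p1 -phaseD addrN phase0.
- by rewrite /= pM /= phaseNK.
- by rewrite /= inner_phase adj inner_phase opprK.
Qed.

Lemma comp_representation (f : A -> A) (pi : A -> {linear Hn -> Hn}) :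
  star_morphism f -> star_representation pi ->
  star_representation (fun a => pi (f a)).
Proof.
move=> [fl f1 fM fs] [bd lin p1 pM adj]; split=> [a|c a b x|x|a b x|a x y].
- exact: bd.
- by rewrite fl lin.
- by rewrite f1 p1.
- by rewrite fM pM.
- by rewrite fs adj.
Qed.

Lemma phase_implements (rho : GLnZhat n) (sigma : R -> A -> A) :
  BC_evolution e mu sigma -> implements e mu rho sigma (fun t => U t : {linear Hn -> Hn}).
Proof.
move=> [[sm _ _ _] smu se]; split.
- by move=> a T aT t x; exact: conj_phase_pi_mu.
- by move=> r T rT t x; exact: conj_phase_pi_e rT.
move=> pi [piR pimu pie] t a x; have [smt _] := sm t.
apply: (rep_unique A_BC (p1 := fun a => pi (sigma t a))
  (p2 := fun a => conj_phase t (pi a))) => [|| r y| b y].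
- exact: comp_representation.
- exact: conj_phase_representation.
- by rewrite se; exact: conj_phase_pi_e (pie r).
- by rewrite smu (repZ piR); exact: conj_phase_pi_mu.
Qed.

Lemma hamiltonian_exists (rho : GLnZhat n) (sigma : R -> A -> A) :
  BC_evolution e mu sigma ->
  exists2 H, hamiltonian e mu rho sigma H & normalized H.
Proof.
move=> sE; exists (lmul_operator (@logdet R n)); last first.
  by move=> b; exact: lmul_delta.
split; [exact: lmul_self_adjoint| |].
  by apply: lmul_positive; exact: logdet_ge0.
exists (fun t => U t); last exact: phase_implements.
exact: lmul_exp_group.
Qed.

End Hamiltonian.

Section Spectrum.
Variables (R : realType) (n : nat).
Local Notation Hn := (ell2 R (posmx n)).
Variable H : operator R (posmx n).
Hypothesis Hsa : self_adjoint H.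
Hypothesis Hnorm : normalized H.

Lemma delta_neq0 (b : posmx n) : (delta b : Hn) != 0.
Proof.
apply/eqP => /(congr1 (fun x : Hn => x b)); rewrite deltaE eqxx ell2_zeroE.
by move/eqP; rewrite oner_eq0.
Qed.

(** By self-adjointness, the coordinate [b] of an eigenvector vanishes unless
    the eigenvalue is the logarithm of the determinant of [b]. *)
Lemma normalized_eigenvalue (l : R[i]) :
  op_eigenvalue H l <-> exists a : posmx n, l = (logdet R a)%:C%C.
Proof.
split=> [[x [Dx xl] x0]|[a ->]]; last first.
  by exists (delta a); [exact: Hnorm|exact: delta_neq0].
have [b xb] : exists b, x b != 0.
  apply: contrapT => nx; move/eqP: x0; apply; apply: ell2P => b.
  by apply/eqP; apply: contrapT => /negP xb; apply: nx; exists b.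
exists b.
have [Db bl] := Hnorm b.
have := (Hsa.2 x (op H x)).2 (conj Dx erefl) _ Db.
rewrite bl xl inner_Zdelta inner_delta ell2_scaleE conj_complexE /= oppr0.
by move=> /(mulIf xb) <-.
Qed.

(** The matrices are the products of [a] by the elementary unipotent matrices
    [1 + k * delta_mx i1 ord0], which are distinct since [a] is invertible over
    the rationals. *)
Lemma infinite_posmx_same_det (n_ge2 : (2 <= n)%N) (a : posmx n) :
  exists2 f : nat -> posmx n, injective f & forall k, \det (f k) = \det a.
Proof.
case: n n_ge2 a => [//|[//|m]] _ a.
pose i1 : 'I_m.+2 := lift ord0 ord0.
pose u (k : nat) : 'M[int]_m.+2 := 1%:M + k%:R *: delta_mx i1 ord0.
have du k : \det (u k) = 1.
  rewrite det_trig; last first.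
    apply/is_trig_mxP => i j ij; rewrite !mxE.
    rewrite (_ : (i == j) = false); last by apply/negP => /eqP ij'; rewrite ij' ltnn in ij.
    by case: eqP => [_|]; case: eqP => [j0|] //=; rewrite ?mulr0 ?addr0//; rewrite j0 in ij.
  rewrite big1// => i _; rewrite !mxE eqxx.
  case: eqP => [->|_] /=; last by rewrite mulr0 addr0.
  by rewrite mulr0 addr0.
have ua_det k : 0 < \det (u k *m a) by rewrite det_mulmx du mul1r posmx_det.
exists (fun k => PosMx (ua_det k)); last by move=> k /=; rewrite det_mulmx du mul1r.
move=> k k' /(congr1 (fun b : posmx m.+2 => (b : 'M[int]_m.+2) *m \adj a)) /=.
rewrite -!mulmxA mul_mx_adj !mul_mx_scalar.
move=> /matrixP /(_ i1 ord0); rewrite !mxE /= => /mulfI.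
rewrite gt_eqF ?posmx_det// => /(_ isT).
by rewrite !add0r !mulr1 => /eqP; rewrite eqr_nat => /eqP.
Qed.

Lemma normalized_eigenspace_infinite (n_ge2 : (2 <= n)%N) (a : posmx n) :
  infinite_dimensional (op_eigenspace H (logdet R a)%:C%C).
Proof.
have [f finj fdet] := infinite_posmx_same_det n_ge2 a.
move=> k; exists (fun i : 'I_k => delta (f i)) => [i|c c0 i].
  by rewrite (_ : logdet R a = logdet R (f i)); [exact: Hnorm|rewrite /logdet fdet].
have := congr1 (fun x : Hn => x (f i)) c0; rewrite ell2_sumE ell2_zeroE => ci.
suff <- : \sum_(j < k) (c j *: (delta (f j) : Hn)) (f i) = c i by [].
rewrite (bigD1 i)//; rewrite big1.
  by rewrite ell2_scaleE deltaE eqxx mulr1; exact: addr0.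
move=> j ji; rewrite ell2_scaleE deltaE (inj_eq finj) (_ : _ == _ = false) ?mulr0//.
by apply/negP => /eqP /val_inj ij; rewrite ij eqxx in ji.
Qed.

End Spectrum.

Theorem lemma3p7 (R : realType) (n : nat) (n_ge2 : (2 <= n)%N)
    (A : cstarType R) (e : 'rV[QmodZ]_n -> A) (mu : posmx n -> A)
    (A_BC : is_BC_algebra e mu) :
  (exists! sigma : R -> A -> A, BC_evolution e mu sigma) /\
  forall sigma : R -> A -> A, BC_evolution e mu sigma ->
  forall rho : GLnZhat n,
    (exists2 H, hamiltonian e mu rho sigma H & normalized H) /\
    forall H, hamiltonian e mu rho sigma H -> normalized H ->
      (forall l : R[i], op_eigenvalue H l <-> exists a : posmx n, l = (logdet R a)%:C%C) /\
      forall a : posmx n,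
        infinite_dimensional (op_eigenspace H (logdet R a)%:C%C).
Proof.
split.
  have [sigma sE] := BC_evolution_exists A_BC.
  by exists sigma; split=> // s; exact: (BC_evolution_unique A_BC sE).
move=> sigma sE rho; split; first exact: hamiltonian_exists.
move=> H [Hsa _ _] Hnorm; split=> [l|a].
  exact: normalized_eigenvalue.
exact: normalized_eigenspace_infinite.
Qed.
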